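(* Let $\varphi_1,\varphi_2\in\mathcal{S}^{(1)}(\mathbb{R}^d)\setminus\{0\}$, $a\in\mathcal{S}^{(1)'}(\mathbb{R}^{2d})$ and $\tau\in[0,1]$. Then $$A_a^{\varphi_1,\varphi_2}=A_{a,\tau}^{\varphi_1,\varphi_2},$$ where $A_a^{\varphi_1,\varphi_2}$ is the localization operator and $A_{a,\tau}^{\varphi_1,\varphi_2}=\mathrm{Op}_\tau\big(a\ast W_\tau(\varphi_2,\varphi_1)\big)$ is the $\tau$-localization operator, both as operators from $\mathcal{S}^{(1)}(\mathbb{R}^d)$ to $\mathcal{S}^{(1)'}(\mathbb{R}^d)$.
   Context: The Gelfand-Shilov space $\mathcal{S}^{(1)}(\mathbb{R}^n)$ is the set of $f\in C^\infty(\mathbb{R}^n)$ such that for every $h>0$, $\sup_{p,q\in\mathbb{N}_0^n}\sup_{x\in\mathbb{R}^n}\frac{|x^p\partial^q f(x)|}{h^{|p|+|q|}\,|p|!\,|q|!}<\infty$, with the projective limit topology over $h>0$. $\mathcal{S}^{(1)'}(\mathbb{R}^n)$ is its topological dual. Brackets $\langle\cdot,\cdot\rangle$ denote the extension to dual pairs of the $L^2$-inner product $\int f\,\overline{g}$ (conjugate-linear in the second entry). $V_gf(x,\omega)=\langle f,M_\omega T_xg\rangle$, with $T_xg(t)=g(t-x)$, $M_\omega g(t)=e^{2\pi i\omega t}g(t)$, is the short-time Fourier transform. Localization operator: $A_a^{\varphi_1,\varphi_2}:\mathcal{S}^{(1)}(\mathbb{R}^d)\to\mathcal{S}^{(1)'}(\mathbb{R}^d)$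 is formally $A_a^{\varphi_1,\varphi_2}f(t)=\iint_{\mathbb{R}^{2d}}a(x,\omega)V_{\varphi_1}f(x,\omega)M_\omega T_x\varphi_2(t)\,dx\,d\omega$, and rigorously is defined by $\langle A_a^{\varphi_1,\varphi_2}f,g\rangle=\langle a,\overline{V_{\varphi_1}f}\,V_{\varphi_2}g\rangle$ for $f,g\in\mathcal{S}^{(1)}(\mathbb{R}^d)$. The (cross-)$\tau$-Wigner distribution of $f,g\in\mathcal{S}^{(1)}(\mathbb{R}^d)$ is $W_\tau(f,g)(x,\omega)=\int_{\mathbb{R}^d}e^{-2\pi it\omega}f(x+\tau t)\overline{g(x-(1-\tau)t)}\,dt$; it belongs to $\mathcal{S}^{(1)}(\mathbb{R}^{2d})$. $\tau$-quantization: for $\sigma\in\mathcal{S}^{(1)'}(\mathbb{R}^{2d})$, $\mathrm{Op}_\tau(\sigma):\mathcal{S}^{(1)}(\mathbb{R}^d)\to\mathcal{S}^{(1)'}(\mathbb{R}^d)$ is formally $\mathrm{Op}_\tau(\sigma)f(x)=\iint_{\mathbb{R}^{2d}}e^{2\pi i(x-y)\omega}\sigma((1-\tau)x+\tau y,\omega)f(y)\,dy\,d\omega$, and rigorously is defined by $\langle\mathrm{Op}_\tau(\sigma)f,g\rangle=\langle\sigma,W_\tau(g,f)\rangle$ for $f,g\in\mathcal{S}^{(1)}(\mathbb{R}^d)$. $a\ast W_\tau(\varphi_2,\varphi_1)$ is the convolution on $\mathbb{R}^{2d}$ of the ultra-distribution $a$ with a test function, formally $(a\ast\Phi)(z)=\int_{\mathbb{R}^{2d}}a(z')\Phi(z-z')\,dz'$.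 *)

(* Defs.v *)
From HB Require Import structures.
From mathcomp Require Import all_boot all_order all_algebra.
From mathcomp Require Import complex.
From mathcomp Require Import all_classical all_reals all_analysis.

Set Implicit Arguments.
Unset Strict Implicit.
Unset Printing Implicit Defensive.

Import Order.TTheory GRing.Theory Num.Theory.
Import numFieldNormedType.Exports.

Local Open Scope classical_set_scope.
Local Open Scope ring_scope.
Local Open Scope complex_scope.

Section consm.
Context (R : realType) (n : nat).
Let mR := measurableTypeR R.
Variable mu : {sigma_finite_measure set (n.-tuple mR) -> \bar R}.

Definition cons_pair (p : mR * n.-tuple mR) : n.+1.-tuple mR :=
  [tuple of p.1 :: p.2].

Lemma measurable_cons_pair : measurable_fun setT cons_pair.
Proof. exact: (measurable_cons measurable_fst measurable_snd). Qed.

Definition consm : set (n.+1.-tuple mR) -> \bar R :=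
  pushforward (product_measure1 (@lebesgue_measure R) mu) cons_pair.

Let consm0 : consm set0 = 0%E.
Proof. by rewrite /consm /pushforward preimage_set0 measure0. Qed.

Let consm_ge0 A : (0 <= consm A)%E.
Proof. by rewrite /consm /pushforward; exact: measure_ge0. Qed.

Let consm_sigma_additive : semi_sigma_additive consm.
Proof.
move=> F mF tF mUF; rewrite /consm /pushforward preimage_bigcup.
apply: measure_semi_sigma_additive.
- by move=> k; rewrite -[X in measurable X]setTI; exact: measurable_cons_pair.
- apply/trivIsetP => /= i j _ _ ij; rewrite -preimage_setI.
  by move/trivIsetP : tF => /(_ i j) ->//; rewrite preimage_set0.
- rewrite -preimage_bigcup -[X in measurable X]setTI.
  exact: measurable_cons_pair.
Qed.

HB.instance Definition _ := isMeasure.Build _ _ _ consm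
  consm0 consm_ge0 consm_sigma_additive.

Let consm_sigma_finite : sigma_finite setT consm.
Proof.
have /sigma_finiteP[F [TF ndF Foo]] := sigma_finiteT (@lebesgue_measure R).
have /sigma_finiteP[G [TG ndG Goo]] := sigma_finiteT mu.
pose uncons (t : n.+1.-tuple mR) : mR * n.-tuple mR :=
  (thead t, [tuple of behead t]).
have munc : measurable_fun setT uncons.
  apply/measurable_fun_pair; last exact: measurable_behead.
  exact: measurable_tnth.
exists (fun k => uncons @^-1` (F k `*` G k)).
  apply/esym; rewrite -subTset => t _ /=.
  have [i _ Fi] : (\bigcup_i F i) (thead t) by rewrite -TF.
  have [j _ Gj] : (\bigcup_i G i) [tuple of behead t] by rewrite -TG.
  exists (maxn i j) => //; split => /=.
    by move: Fi; exact/subsetPset/ndF/leq_maxl.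
  by move: Gj; exact/subsetPset/ndG/leq_maxr.
move=> k; have [mF Fk] := Foo k; have [mG Gk] := Goo k; split.
  by rewrite -[X in measurable X]setTI; apply: munc => //; exact: measurableX.
rewrite /consm /pushforward -comp_preimage (_ : uncons \o cons_pair = id).
  rewrite preimage_id product_measure1E// lte_mul_pinfty// ge0_fin_numE//.
by apply/funext => -[x t]; congr pair; exact: val_inj.
Qed.

HB.instance Definition _ := Measure_isSigmaFinite.Build _ _ _ consm
  consm_sigma_finite.

End consm.

(* The n-fold product of the Lebesgue measure on R (a point mass if n = 0). *)
Fixpoint lebesgue_tuple (R : realType) (n : nat) :
    {sigma_finite_measure set (n.-tuple (measurableTypeR R)) -> \bar R} :=
  if n is m.+1 then consm (lebesgue_tuple R m)
  else @dirac _ _ ([tuple] : 0.-tuple (measurableTypeR R)) R.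

Section integration.
Context (R : realType) (n : nat).

Definition integralRn (f : 'rV[R]_n -> R) : R :=
  Rintegral (lebesgue_tuple R n) setT (fun t => f (\row_i tnth t i)).

Definition integralCn (f : 'rV[R]_n -> R[i]) : R[i] :=
  integralRn (fun x => complex.Re (f x)) +i* integralRn (fun x => complex.Im (f x)).

Definition inner_product (f g : 'rV[R]_n -> R[i]) : R[i] :=
  integralCn (fun x => f x * (g x)^*).

End integration.

Section gelfand_shilov.
Context (R : realType) (n : nat).
Implicit Types (f g : 'rV[R]_n -> R[i]) (p q : 'I_n -> nat).

Definition partial (i : 'I_n) (f : 'rV[R]_n -> R) : 'rV[R]_n -> R :=
  fun x => 'D_(delta_mx 0 i) f x.

Fixpoint is_Ck (k : nat) (f : 'rV[R]_n -> R) : Prop :=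
  continuous f /\
  if k is k'.+1 then
    forall i, (forall x, derivable f x (delta_mx 0 i)) /\ is_Ck k' (partial i f)
  else True.

Definition smooth f : Prop :=
  forall k, is_Ck k (fun x => complex.Re (f x)) /\ is_Ck k (fun x => complex.Im (f x)).

Definition mpartialR q (f : 'rV[R]_n -> R) : 'rV[R]_n -> R :=
  foldr (fun i => iter (q i) (partial i)) f (enum 'I_n).

Definition mpartial q f : 'rV[R]_n -> R[i] :=
  fun x => mpartialR q (fun y => complex.Re (f y)) x
           +i* mpartialR q (fun y => complex.Im (f y)) x.

Definition mnorm p : nat := (\sum_i p i)%N.

Definition monomial p (x : 'rV[R]_n) : R := \prod_i x 0 i ^+ p i.

Definition GS_norm (h : R) f : \bar R :=
  ereal_sup [set r : \bar R | exists p q x,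
    r = (`|monomial p x| * Normc.normc (mpartial q f x) /
         (h ^+ (mnorm p + mnorm q) * (mnorm p)`!%:R * (mnorm q)`!%:R))%:E].

Definition GS : set ('rV[R]_n -> R[i]) :=
  [set f | smooth f /\ forall h : R, 0 < h -> (GS_norm h f < +oo)%E].

(* A functional is a total map on all functions, as for other partial operations
   totalized with unspecified values: only its values on [GS] are meaningful, and
   elements of the dual are to be compared on [GS] only. *)
Definition functional : Type := ('rV[R]_n -> R[i]) -> R[i].

Definition GS_linear (u : functional) : Prop :=
  forall (c : R[i]) f g, GS f -> GS g ->
    u (fun x => c * f x + g x) = c * u f + u g.

(* Continuity for the projective limit topology: since [GS_norm h] is
   nonincreasing in [h], the balls of the single norms [GS_norm h], [0 < h],
   form neighbourhood bases. *)
Definition GS_continuous (u : functional) : Prop :=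
  forall f, GS f -> forall e : R, 0 < e ->
    exists h delta : R, [/\ 0 < h, 0 < delta &
      forall g, GS g -> (GS_norm h (fun x => g x - f x)%R < delta%:E)%E ->
        Normc.normc (u g - u f) < e].

Definition GS_dual : set functional :=
  [set u | GS_linear u /\ GS_continuous u].

(* The elements of the dual are complex-linear, so the pairing extending
   [inner_product], antilinear in its second entry, conjugates the test
   function. *)
Definition bracket (u : functional) g : R[i] := u (fun x => (g x)^*).

(* The functional [u] determined by [bracket u g = B g]. *)
Definition functional_of_bracket (B : ('rV[R]_n -> R[i]) -> R[i]) : functional :=
  fun g => B (fun x => (g x)^*).

Lemma bracketE B g : bracket (functional_of_bracket B) g = B g.
Proof.
rewrite /bracket /functional_of_bracket; congr B.
by apply/funext => x; rewrite conjcK.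
Qed.

End gelfand_shilov.

(* Points (x, omega) of phase space R^(2d) are encoded as
   [z = row_mx x omega : 'rV[R]_(d + d)]. *)

Section time_frequency.
Context (R : realType) (d : nat).
Implicit Types (f g : 'rV[R]_d -> R[i]) (z : 'rV[R]_(d + d)).

Definition dot (x y : 'rV[R]_d) : R := \sum_i x 0 i * y 0 i.

Definition cis2pi (s : R) : R[i] :=
  cos (2 * pi * s) +i* sin (2 * pi * s).

Definition translation (x : 'rV[R]_d) g : 'rV[R]_d -> R[i] :=
  fun t => g (t - x).

Definition modulation (omega : 'rV[R]_d) g : 'rV[R]_d -> R[i] :=
  fun t => cis2pi (dot omega t) * g t.

Definition STFT g f : 'rV[R]_(d + d) -> R[i] :=
  fun z => inner_product f (modulation (rsubmx z) (translation (lsubmx z) g)).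

Definition wigner (tau : R) f g : 'rV[R]_(d + d) -> R[i] :=
  fun z => let x := lsubmx z in let omega := rsubmx z in
    integralCn (fun t => cis2pi (- dot t omega) *
      f (x + tau *: t) * (g (x - (1 - tau) *: t))^*).

Definition loc_op (phi1 phi2 : 'rV[R]_d -> R[i]) (a : functional R (d + d)) f :
    functional R d :=
  functional_of_bracket (fun g =>
    bracket a (fun z => (STFT phi1 f z)^* * STFT phi2 g z)).

Definition tau_quantization (tau : R) (sigma : functional R (d + d)) f :
    functional R d :=
  functional_of_bracket (fun g => bracket sigma (wigner tau g f)).

End time_frequency.

(* Convolution of an ultradistribution with a test function, by duality:
   <a * Phi, F> = <a, z' |-> int F(z) (Phi (z - z'))^* dz>, which is what
   (a * Phi) z = int a(z') Phi(z - z') dz' gives after exchanging the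
   integrals in int (a * Phi)(z) (F z)^* dz. *)
Definition convolution (R : realType) (n : nat) (a : functional R n)
    (Phi : 'rV[R]_n -> R[i]) : functional R n :=
  functional_of_bracket (fun F =>
    bracket a (fun z' => integralCn (fun z => F z * (Phi (z - z'))^*))).

Definition tau_loc_op (R : realType) (d : nat) (tau : R)
    (phi1 phi2 : 'rV[R]_d -> R[i]) (a : functional R (d + d))
    (f : 'rV[R]_d -> R[i]) : functional R d :=
  tau_quantization tau (convolution a (wigner tau phi2 phi1)) f.

(* Main.v *)
From HB Require Import structures.
Require Import Defs.
From mathcomp Require Import all_boot all_order all_algebra.
From mathcomp Require Import complex.
From mathcomp Require Import all_classical all_reals all_analysis.
From mathcomp Require Import measurable_realfun.
From mathcomp Require Import ring lra.
Import Order.TTheory GRing.Theory Num.Theory.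
Import numFieldNormedType.Exports.
Local Open Scope classical_set_scope.
Local Open Scope ring_scope.
Local Open Scope complex_scope.
Set Implicit Arguments.
Unset Strict Implicit.
Unset Printing Implicit Defensive.

(** Both operators are obtained by applying the same ultradistribution [a] to a
    test function on phase space, so the theorem reduces to the equality of two
    test functions, that is, to the pointwise identity
      int W_tau(g, f)(z) conj(W_tau(phi2, phi1)(z - z')) dz
        = conj(V_phi1 f (z')) V_phi2 g (z'),
    which is [wigner_convolution_STFT].

    By covariance under phase-space shifts ([wignerB]), W_tau(phi2, phi1)(z - z')
    is the tau-Wigner distribution at z of the pair of shifted windows
    M_w' T_x' phi2 and M_w' T_x' phi1, where z' = (x', w').  The identity is
    therefore an instance of Moyal's identity ([moyal])
      int W_tau(f, g) conj(W_tau(phi, psi))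
        = (int f conj(phi)) (int conj(g) psi).
    For a fixed x, the function W_tau(f, g)(x, .) is the Fourier transform of the
    slice t |-> f(x + tau t) conj(g(x - (1 - tau) t)).  Parseval's identity
    ([parseval]) turns the integral over the frequency into an integral over t,
    and the change of variables (x, t) |-> (x + tau t, x - (1 - tau) t), which
    preserves Lebesgue measure ([ge0_integral_shear]), separates the variables.
    Fubini's theorem applies to the double integral over x and the frequency
    because Wigner distributions are square integrable; this follows from
    Plancherel's identity in each slice and Tonelli's theorem
    ([integrable_fourier_slice_sqr]).

    Parseval's identity is proved for bounded continuous integrable functions by
    damping the frequency integral with w |-> prod_i exp(- 2 pi e |w_i|).  The
    Fourier transform of this factor is a product of Poisson kernels, an
    approximate identity ([cint_damping_rv]), and e tends to 0.

    The Gelfand-Shilov space enters through the continuity of its elements and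
    their domination by a multiple of prod_i (1 + x_i^2)^-1 ([GS_decaying]), which
    makes the Fourier transforms, the slices and the exchanges of integrals above
    absolutely convergent. *)

(* Inside ring expressions, [^*] otherwise denotes the conjugation of an abstract
   closed field, which is convertible but not syntactically equal to [conjc]. *)
Local Notation "x ^*" := (conjc x) : ring_scope.

(** * Row vectors as a measurable space *)

Section row_vector_measurable.
Context (R : realType) (n : nat).

Definition rv_coord (i : 'I_n) (x : 'rV[R]_n) : measurableTypeR R := x 0 i.

Let rv_set0 : g_sigma_preimage rv_coord set0.
Proof. exact: sigma_algebra0. Qed.

Let rv_setC A : g_sigma_preimage rv_coord A -> g_sigma_preimage rv_coord (~` A).
Proof. exact: sigma_algebraC. Qed.

Let rv_bigcup (F : _^nat) : (forall i, g_sigma_preimage rv_coord (F i)) ->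
  g_sigma_preimage rv_coord (\bigcup_i (F i)).
Proof. exact: sigma_algebra_bigcup. Qed.

HB.instance Definition _ := @isMeasurable.Build
  (measure_tuple_display default_measure_display) ('rV[R]_n)
  (g_sigma_preimage rv_coord) rv_set0 rv_setC rv_bigcup.

Lemma measurable_rv_coord (i : 'I_n) :
  measurable_fun [set: 'rV[R]_n] (fun x => x 0 i : R).
Proof.
move=> _ Y mY; rewrite setTI; apply: sub_sigma_algebra => /=.
rewrite -bigcup_seq/=; exists i => /=; first by rewrite mem_index_enum.
by exists Y => //; rewrite setTI.
Qed.

Lemma measurable_fun_rvP d (T : measurableType d) (f : T -> 'rV[R]_n) :
  (forall i, measurable_fun setT (fun t => f t 0 i)) -> measurable_fun setT f.
Proof.
move=> mf.
suff : g_sigma_preimage (fun i => rv_coord i \o f) `<=` measurable.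
  rewrite g_sigma_preimage_comp => prefS.
  by move=> _ A mA; apply: prefS; exists A.
apply: smallest_sub; first exact: sigma_algebra_measurable.
rewrite -bigcup_seq => A [i _ [B mB <-]].
by apply: mf.
Qed.

(** An open set is the union of the cubes with rational centre and radius
    1/(k + 1) that it contains, and there are countably many of them. *)
Lemma open_measurable_rv (U : set 'rV[R]_n) : open U -> measurable U.
Proof.
move=> oU.
pose B (qk : 'rV[rat]_n * nat) : set 'rV[R]_n :=
  \bigcap_i [set x | `|x 0 i - ratr (qk.1 0 i)| < qk.2.+1%:R^-1].
have mB qk : measurable (B qk).
  apply: fin_bigcap_measurable; first exact: finite_finset.
  move=> i _.
  have mabs : measurable_fun setT
      (fun x : 'rV[R]_n => `|x 0 i - ratr (qk.1 0 i)| : R).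
    apply: (measurableT_comp (f := fun z : R => `|z|)) => //.
    apply: measurable_funB => //; exact: measurable_rv_coord.
  rewrite -[X in measurable X]setTI.
  by have := mabs measurableT _ (@measurable_itv R `]-oo, (qk.2.+1%:R^-1 : R)[);
    rewrite set_itvE.
(* The union ranges over all cubes, so those that leave [U] are replaced by the
   empty set. *)
rewrite (_ : U = \bigcup_qk (if `[<B qk `<=` U>] then B qk else set0)).
  apply: countable_bigcupT_measurable; first exact: countableP.
  by move=> qk; case: ifP.
apply/seteqP; split => [x Ux|x [qk _]]; last first.
  by case: ifPn => // /asboolP; exact.
have := open_nbhs_nbhs (conj oU Ux) => /nbhs_ballP[e /= e0 eU].
have [k ke] : exists k : nat, (k.+1%:R^-1 : R) < e / 2.
  have e20 : 0 < e / 2 by rewrite divr_gt0.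
  have [k _ /(_ k (leqnn k))] := near_infty_natSinv_lt (PosNum e20).
  by exists k.
have ex i : exists q : rat, `|x 0 i - ratr q| < k.+1%:R^-1 :> R.
  have : x 0 i - k.+1%:R^-1 < x 0 i + k.+1%:R^-1 :> R.
    by rewrite ltrD2l gt0_cp// invr_gt0.
  move=> /rat_in_itvoo[q]; rewrite in_itv/= => /andP[q1 q2]; exists q.
  by rewrite distrC ltr_distl q1 q2.
have [q hq] := choice ex.
exists (\row_i q i, k) => //.
(* Within the cube, distances to [x] are below twice the radius, hence the [e / 2]
   above. *)
rewrite ifT; first by move=> i _ /=; rewrite mxE.
apply/asboolP => y By; apply: eU.
apply: (fun h => conj e0 h) => i j; rewrite ord1.
have := By j I; rewrite /= mxE => yj; have xj := hq j.
rewrite /ball/=.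
rewrite (_ : _ - _ = (x 0 j - ratr (q j)) - (y 0 j - ratr (q j))); last by ring.
rewrite (le_lt_trans (ler_normB _ _))//.
by rewrite (lt_trans (ltrD xj yj))// (splitr e) ltrD.
Qed.

Lemma continuous_measurable_rv (f : 'rV[R]_n -> R) :
  continuous f -> measurable_fun setT f.
Proof.
move=> /continuousP cf; apply: (measurability _ (RGenOpens.measurableE R)).
move=> _ [_ [a [b ->] <-]]; rewrite setTI; apply: open_measurable_rv.
exact/cf/interval_open.
Qed.

End row_vector_measurable.

(** * Lebesgue measure on row vectors *)

Section lebesgue_rv.
Context (R : realType) (n : nat).

Definition row_of_tuple (t : n.-tuple (measurableTypeR R)) : 'rV[R]_n :=
  \row_i tnth t i.

Definition tuple_of_row (x : 'rV[R]_n) : n.-tuple (measurableTypeR R) :=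
  [tuple x 0 i | i < n].

Lemma row_of_tupleK : cancel row_of_tuple tuple_of_row.
Proof. by move=> t; apply: eq_from_tnth => i; rewrite tnth_mktuple mxE. Qed.

Lemma measurable_row_of_tuple : measurable_fun setT row_of_tuple.
Proof.
apply: measurable_fun_rvP => i.
under eq_fun do rewrite mxE.
exact: measurable_tnth.
Qed.

Lemma measurable_tuple_of_row : measurable_fun setT tuple_of_row.
Proof.
apply/measurable_fun_tnthP => i.
rewrite (_ : _ \o _ = fun x : 'rV[R]_n => x 0 i); first exact: measurable_rv_coord.
by apply/funext => x /=; rewrite tnth_mktuple.
Qed.

(** Lebesgue measure transported from tuples to row vectors, on which the vector
    space operations and the topology live. *)
Definition lebesgue_rv : set 'rV[R]_n -> \bar R :=
  pushforward (lebesgue_tuple R n) row_of_tuple.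

Let lebesgue_rv0 : lebesgue_rv set0 = 0%E.
Proof. by rewrite /lebesgue_rv /pushforward preimage_set0 measure0. Qed.

Let lebesgue_rv_ge0 A : (0 <= lebesgue_rv A)%E.
Proof. by rewrite /lebesgue_rv /pushforward; exact: measure_ge0. Qed.

Let lebesgue_rv_sigma_additive : semi_sigma_additive lebesgue_rv.
Proof.
move=> F mF tF mUF; rewrite /lebesgue_rv /pushforward preimage_bigcup.
apply: measure_semi_sigma_additive.
- by move=> k; rewrite -[X in measurable X]setTI; exact: measurable_row_of_tuple.
- apply/trivIsetP => /= i j _ _ ij; rewrite -preimage_setI.
  by move/trivIsetP : tF => /(_ i j) ->//; rewrite preimage_set0.
- rewrite -preimage_bigcup -[X in measurable X]setTI.
  exact: measurable_row_of_tuple.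
Qed.

HB.instance Definition _ := isMeasure.Build _ _ _ lebesgue_rv
  lebesgue_rv0 lebesgue_rv_ge0 lebesgue_rv_sigma_additive.

Let lebesgue_rv_sigma_finite : sigma_finite setT lebesgue_rv.
Proof.
have /sigma_finiteP[F [TF _ Foo]] := sigma_finiteT (lebesgue_tuple R n).
exists (fun k => tuple_of_row @^-1` F k).
  by rewrite -preimage_bigcup -TF preimage_setT.
move=> k; have [mF Fk] := Foo k; split.
  by rewrite -[X in measurable X]setTI; exact: measurable_tuple_of_row.
rewrite /lebesgue_rv /pushforward -comp_preimage.
by rewrite (_ : tuple_of_row \o row_of_tuple = id)//; apply/funext/row_of_tupleK.
Qed.

HB.instance Definition _ := Measure_isSigmaFinite.Build _ _ _ lebesgue_rv
  lebesgue_rv_sigma_finite.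

End lebesgue_rv.
Arguments lebesgue_rv {R} n.

(** A change of variables for nonnegative functions extends to all measurable
    functions because it commutes with taking positive and negative parts. *)
Lemma eq_integral_ge0 d1 d2 (T1 : measurableType d1) (T2 : measurableType d2)
    (R : realType) (m1 : {measure set T1 -> \bar R})
    (m2 : {measure set T2 -> \bar R}) (S : T1 -> T2) :
  (forall f : T2 -> \bar R, measurable_fun setT f -> (forall y, 0 <= f y)%E ->
    (\int[m2]_y f y = \int[m1]_x f (S x))%E) ->
  forall f : T2 -> \bar R, measurable_fun setT f ->
  (\int[m2]_y f y = \int[m1]_x f (S x))%E.
Proof.
move=> H f mf; rewrite integralE [RHS]integralE; congr (_ - _)%E.
- rewrite H; [|exact: measurable_funepos|exact: funepos_ge0].
  by apply: eq_integral => x _; rewrite !funeposE.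
- rewrite H; [|exact: measurable_funeneg|exact: funeneg_ge0].
  by apply: eq_integral => x _; rewrite !funenegE.
Qed.

Section lebesgue_rv_integral.
Context (R : realType).

Lemma integral_lebesgue_rv n (f : 'rV[R]_n -> \bar R) :
  measurable_fun setT f ->
  (\int[lebesgue_rv n]_x f x
   = \int[lebesgue_tuple R n]_t f (row_of_tuple t))%E.
Proof.
move: f; apply: eq_integral_ge0 => f mf f0.
by rewrite -(ge0_integral_pushforward (@measurable_row_of_tuple R n)
  (lebesgue_tuple R n) measurableT mf (fun y _ => f0 y)).
Qed.

Lemma integralRnE n (f : 'rV[R]_n -> R) : measurable_fun setT f ->
  integralRn f = Rintegral (lebesgue_rv n) setT f.
Proof.
move=> mf; rewrite /integralRn /Rintegral integral_lebesgue_rv//.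
exact/measurable_EFinP.
Qed.

Definition cons_rv n (p : measurableTypeR R * 'rV[R]_n) : 'rV[R]_n.+1 :=
  row_mx (p.1 : R)%:M p.2 : 'rV_(1 + n).

Lemma cons_rv0 n (p : measurableTypeR R * 'rV[R]_n) : cons_rv p 0 ord0 = p.1 :> R.
Proof.
have -> : (ord0 : 'I_n.+1) = lshift n (ord0 : 'I_1) by exact: val_inj.
by rewrite [LHS]row_mxEl mxE.
Qed.

Lemma cons_rvS n (p : measurableTypeR R * 'rV[R]_n) (i : 'I_n) : cons_rv p 0 (lift ord0 i) = p.2 0 i.
Proof.
have -> : lift ord0 i = rshift 1 i by exact: val_inj.
by rewrite [LHS]row_mxEr.
Qed.

Lemma measurable_cons_rv n : measurable_fun setT (@cons_rv n).
Proof.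
apply: measurable_fun_rvP => i.
case: (unliftP ord0 i) => [j ->|->].
  under eq_fun do rewrite cons_rvS.
  by apply: (measurableT_comp (measurable_rv_coord j)); exact: measurable_snd.
by under eq_fun do rewrite cons_rv0; exact: measurable_fst.
Qed.

Lemma integral_lebesgue_rv0 (f : 'rV[R]_0 -> \bar R) :
  measurable_fun setT f -> (\int[lebesgue_rv 0]_x f x)%E = f 0.
Proof.
move=> mf; rewrite integral_lebesgue_rv// integral_dirac//.
  rewrite diracE mem_set// mul1e; congr f; apply/rowP; case=> //.
by apply: measurableT_comp => //; exact: measurable_row_of_tuple.
Qed.

Lemma cons_rv_row_of_tuple n (p : measurableTypeR R * n.-tuple (measurableTypeR R)) :
  row_of_tuple (cons_pair p) = cons_rv (p.1, row_of_tuple p.2).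
Proof.
apply/rowP => i; rewrite mxE.
case: (unliftP ord0 i) => [j ->|->]; last by rewrite cons_rv0.
by rewrite cons_rvS mxE tnthS.
Qed.

(** The recursion that makes induction on the dimension possible. *)
Lemma integral_lebesgue_rvS n (f : 'rV[R]_n.+1 -> \bar R) :
  measurable_fun setT f ->
  (\int[lebesgue_rv n.+1]_x f x
   = \int[lebesgue_measure \x lebesgue_rv n]_p f (cons_rv p))%E.
Proof.
move: f; apply: eq_integral_ge0 => f mf f0.
rewrite -(ge0_integral_pushforward (@measurable_cons_rv n)
  (lebesgue_measure \x lebesgue_rv n)%E measurableT mf (fun y _ => f0 y)).
apply: eq_measure_integral => [|mc A mA _]; first exact: measurable_cons_rv.
rewrite /= /lebesgue_rv /pushforward/= /consm /pushforward /product_measure1/=.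
apply: eq_integral => a _ /=; congr (lebesgue_tuple R n _).
apply/funext => t /=; rewrite /xsection/=.
by apply/propext; rewrite !inE/= cons_rv_row_of_tuple.
Qed.

Lemma ge0_integral_lebesgue_rvS n (f : 'rV[R]_n.+1 -> \bar R) :
  measurable_fun setT f -> (forall x, 0 <= f x)%E ->
  (\int[lebesgue_rv n.+1]_x f x
   = \int[lebesgue_measure]_a \int[lebesgue_rv n]_x f (cons_rv (a, x)))%E.
Proof.
move=> mf f0; rewrite integral_lebesgue_rvS//.
rewrite fubini_tonelli1//.
by apply: measurableT_comp => //; exact: measurable_cons_rv.
Qed.

(** Both sides define measures on the line that agree on half-open intervals. *)
Lemma ge0_integral_affine (a b : R) (f : R -> \bar R) : a != 0 ->
  measurable_fun setT f -> (forall x, 0 <= f x)%E ->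
  (\int[lebesgue_measure]_x f x
   = `|a|%:E * \int[lebesgue_measure]_x f (a * x + b)%R)%E.
Proof.
move=> a0 mf f0.
pose T : measurableTypeR R -> measurableTypeR R := fun x => a * x + b.
have mT : measurable_fun setT T.
  by apply: measurable_funD => //; exact: mulrl_measurable.
have mfT : measurable_fun setT (f \o T) by exact: measurableT_comp.
have -> : (\int[lebesgue_measure]_x f (a * x + b)%R
    = \int[pushforward lebesgue_measure T]_x f x)%E.
  by rewrite (ge0_integral_pushforward mT).
rewrite -(ge0_integral_mscale _ _ (NngNum (normr_ge0 a)))//.
apply: eq_measure_integral => A mA _.
apply: lebesgue_measure_unique => // _ [[c e] _ <-].
transitivity (`|a|%:E * lebesgue_measure (T @^-1` `]c, e]%classic))%E; last by [].
rewrite [LHS]lebesgue_measure_itv/=.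
have [a_gt0|a_lt0|a_eq0] := ltgtP 0 a; last by rewrite -a_eq0 eqxx in a0.
- rewrite (_ : T @^-1` _ = `](c - b) / a, (e - b) / a]%classic); last first.
    apply/seteqP; split => x; rewrite /T/= !in_itv/=.
      by rewrite ltr_pdivrMr// ler_pdivlMr// ltrBlDr lerBrDr mulrC.
    by rewrite ltr_pdivrMr// ler_pdivlMr// ltrBlDr lerBrDr mulrC.
  rewrite lebesgue_measure_itv/= !lte_fin ltr_pM2r ?invr_gt0// ltrD2r.
  case: ifP => ce; last by rewrite mule0.
  rewrite -!EFinB -EFinM gtr0_norm//; congr EFin.
  by field.
- rewrite (_ : T @^-1` _ = `[(e - b) / a, (c - b) / a[%classic); last first.
    apply/seteqP; split => x; rewrite /T/= !in_itv/=.
      by rewrite ler_ndivrMr// ltr_ndivlMr// ltrBlDr lerBrDr mulrC andbC.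
    by rewrite ler_ndivrMr// ltr_ndivlMr// ltrBlDr lerBrDr mulrC andbC.
  rewrite lebesgue_measure_itv/= !lte_fin ltr_nM2r ?invr_lt0// ltrD2r.
  case: ifP => ce; last by rewrite mule0.
  rewrite -!EFinB -EFinM ltr0_norm//; congr EFin.
  by field.
Qed.

(** One factor [`|a|] for each coordinate, by induction on the dimension. *)
Lemma ge0_integral_rv_affine n (a : R) (b : 'rV[R]_n) (f : 'rV[R]_n -> \bar R) :
  a != 0 -> measurable_fun setT f -> (forall x, 0 <= f x)%E ->
  (\int[lebesgue_rv n]_x f x
   = (`|a| ^+ n)%:E * \int[lebesgue_rv n]_x f (a *: x + b)%R)%E.
Proof.
move=> a0.
have maff m (c : 'rV[R]_m) : measurable_fun setT (fun x : 'rV[R]_m => a *: x + c).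
  apply: measurable_fun_rvP => i.
  under eq_fun do rewrite !mxE.
  apply: measurable_funD => //.
  by apply: measurable_funM => //; exact: measurable_rv_coord.
elim: n b f => [|n IH] b f mf f0.
  rewrite !integral_lebesgue_rv0//; last exact: (measurableT_comp mf (maff _ _)).
  by rewrite expr0 mul1e; congr f; apply/rowP; case.
pose b' : 'rV[R]_n := \row_i b 0 (lift ord0 i).
have affE s x : a *: cons_rv (s, x) + b = cons_rv (a * s + b 0 ord0, a *: x + b').
  apply/rowP => i; rewrite [LHS]mxE [X in X + _ = _]mxE.
  by case: (unliftP ord0 i) => [j ->|->]; rewrite ?cons_rvS ?cons_rv0//= ?mxE.
rewrite ge0_integral_lebesgue_rvS// [in RHS]ge0_integral_lebesgue_rvS//; last first.
  exact: (measurableT_comp mf (maff _ _)).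
have mfc : measurable_fun setT (fun p : measurableTypeR R * 'rV[R]_n => f (cons_rv p)).
  by apply: measurableT_comp => //; exact: measurable_cons_rv.
have mfcs s : measurable_fun setT (fun x : 'rV[R]_n => f (cons_rv (s, x))).
  by apply: (measurableT_comp mfc); exact: measurable_pair1.
have mF : measurable_fun setT (fun s => \int[lebesgue_rv n]_x f (cons_rv (s, x)))%E.
  by apply: (measurable_fun_fubini_tonelli_F (m2 := lebesgue_rv n) _ mfc).
have F0 s : (0 <= \int[lebesgue_rv n]_x f (cons_rv (s, x)))%E.
  by apply: integral_ge0.
rewrite (ge0_integral_affine (b 0 ord0) a0 mF F0).
under [X in (_ * X)%E = _]eq_integral => s _ do
  rewrite (IH b' (fun x => f (cons_rv (a * s + b 0 ord0, x)))) //.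
rewrite ge0_integralZl//; last 2 first.
- rewrite (_ : (fun _ => _) = (fun p => \int[lebesgue_rv n]_x f (a *: cons_rv (p, x) + b)%R)%E).
    apply: (measurable_fun_fubini_tonelli_F (m2 := lebesgue_rv n)
      (fun p => f (a *: cons_rv p + b))) => //.
    apply: measurableT_comp => //; apply: (measurableT_comp (maff _ _)).
    exact: measurable_cons_rv.
  by apply/funext => s; apply: eq_integral => x _; rewrite affE.
- by move=> s _; apply: integral_ge0.
rewrite muleA -EFinM -exprS; congr (_ * _)%E.
by apply: eq_integral => s _; apply: eq_integral => x _; rewrite affE.
Qed.

Lemma measurable_row_mx m n :
  measurable_fun setT (fun p : 'rV[R]_m * 'rV[R]_n => row_mx p.1 p.2).
Proof.
apply: measurable_fun_rvP => i.
case: (split_ordP i) => j ->.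
- under eq_fun do rewrite row_mxEl.
  by apply: (measurableT_comp (measurable_rv_coord j)); exact: measurable_fst.
- under eq_fun do rewrite row_mxEr.
  by apply: (measurableT_comp (measurable_rv_coord j)); exact: measurable_snd.
Qed.

Lemma row_mx_cons_rv m n (s : R) (x : 'rV[R]_m) (y : 'rV[R]_n) :
  row_mx (cons_rv (s, x)) y = cons_rv (s, row_mx x y) :> 'rV_(m + n).+1.
Proof.
apply/rowP => i; case: (unliftP ord0 i) => [j ->|->]; last first.
  have -> : ord0 = lshift n (ord0 : 'I_m.+1) by exact: val_inj.
  rewrite [LHS]row_mxEl cons_rv0.
  have -> : lshift n (ord0 : 'I_m.+1) = ord0 :> 'I_(m + n).+1 by exact: val_inj.
  by rewrite [RHS]cons_rv0.
rewrite [RHS]cons_rvS; case: (split_ordP j) => k ->.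
- have -> : lift ord0 (lshift n k) = lshift n (lift ord0 k) by exact: val_inj.
  by rewrite [LHS]row_mxEl cons_rvS row_mxEl.
- have -> : lift ord0 (rshift m k) = rshift m.+1 k by exact: val_inj.
  by rewrite [LHS]row_mxEr row_mxEr.
Qed.

Lemma ge0_integral_row_mx m n (f : 'rV[R]_(m + n) -> \bar R) :
  measurable_fun setT f -> (forall x, 0 <= f x)%E ->
  (\int[lebesgue_rv (m + n)]_z f z
   = \int[lebesgue_rv m]_x \int[lebesgue_rv n]_y f (row_mx x y))%E.
Proof.
have mx1 k l (x : 'rV[R]_k) : measurable_fun setT (fun y : 'rV[R]_l => row_mx x y).
  exact: (measurableT_comp (@measurable_row_mx k l) (measurable_pair1 x)).
elim: m f => [|m IH] f mf f0.
  rewrite integral_lebesgue_rv0.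
    by apply: eq_integral => y _; rewrite row_thin_mx.
  apply: (measurable_fun_fubini_tonelli_F (m2 := lebesgue_rv n)
    (fun p : 'rV[R]_0 * 'rV[R]_n => f (row_mx p.1 p.2))) => //.
  by apply: measurableT_comp => //; exact: measurable_row_mx.
rewrite [LHS](ge0_integral_lebesgue_rvS (n := (m + n)%N))//.
rewrite [RHS]ge0_integral_lebesgue_rvS; last 2 first.
- apply: (measurable_fun_fubini_tonelli_F (m2 := lebesgue_rv n)
    (fun p : 'rV[R]_m.+1 * 'rV[R]_n => f (row_mx p.1 p.2))) => //.
  by apply: measurableT_comp => //; exact: measurable_row_mx.
- by move=> x; apply: integral_ge0.
apply: eq_integral => s _.
have mfs : measurable_fun setT (fun z : 'rV[R]_(m + n) => f (cons_rv (s, z))).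
  exact: (measurableT_comp mf (measurableT_comp (@measurable_cons_rv _) (measurable_pair1 s))).
rewrite (IH _ mfs (fun z => f0 _)).
by apply: eq_integral => x _; apply: eq_integral => y _; rewrite row_mx_cons_rv.
Qed.

End lebesgue_rv_integral.

(** * Integration of complex-valued functions *)

Section normc_facts.
Context {R : realType}.
Implicit Types z w : R[i].
Notation normc := Normc.normc.

Lemma Re_cM z w : complex.Re (z * w) =
  complex.Re z * complex.Re w - complex.Im z * complex.Im w.
Proof. by case: z w => [a b] [c d]. Qed.

Lemma Im_cM z w : complex.Im (z * w) =
  complex.Re z * complex.Im w + complex.Im z * complex.Re w.
Proof. by case: z w => [a b] [c d]. Qed.

Lemma normcJ z : normc z^* = normc z.
Proof. by case: z => a b; rewrite /= sqrrN. Qed.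

Lemma conjcM z w : (z * w)^* = z^* * w^*.
Proof. exact: (rmorphM (@conjc R)). Qed.

Lemma normc_ge0 z : 0 <= normc z.
Proof. by case: z => a b; rewrite sqrtr_ge0. Qed.

Lemma normr_Re_le z : `|complex.Re z| <= normc z.
Proof. by case: z => a b /=; rewrite -sqrtr_sqr ler_wsqrtr// lerDl sqr_ge0. Qed.

Lemma normr_Im_le z : `|complex.Im z| <= normc z.
Proof. by case: z => a b /=; rewrite -sqrtr_sqr ler_wsqrtr// lerDr sqr_ge0. Qed.

Lemma normc_le z : normc z <= `|complex.Re z| + `|complex.Im z|.
Proof.
case: z => a b /=.
rewrite -[leRHS]ger0_norm ?addr_ge0// -sqrtr_sqr ler_wsqrtr// sqrrD.
by rewrite !real_normK ?num_real// addrAC lerDl mulrn_wge0 ?mulr_ge0.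
Qed.

Lemma normc_sqr z : normc z ^+ 2 = complex.Re (z * z^*).
Proof.
by case: z => a b /=; rewrite sqr_sqrtr ?addr_ge0 ?sqr_ge0//; ring.
Qed.

Lemma normc_real (x : R) : normc x%:C = `|x|.
Proof. by rewrite /= expr0n/= addr0 sqrtr_sqr. Qed.

End normc_facts.

Section cintegral.
Context d (T : measurableType d) {R : realType}.
Implicit Types (f g : T -> R[i]).
Notation normc := Normc.normc.

(** Complex integration is defined through real and imaginary parts, matching
    [integralCn]. *)
Definition cmeasurable f :=
  measurable_fun setT (fun x => complex.Re (f x)) /\
  measurable_fun setT (fun x => complex.Im (f x)).

Lemma cmeasurable_real (u : T -> R) :
  measurable_fun setT u -> cmeasurable (fun x => (u x)%:C).
Proof. by split => //=. Qed.

Lemma cmeasurable_cst (c : R[i]) : cmeasurable (fun=> c).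
Proof. by split; exact: measurable_cst. Qed.

Lemma cmeasurableM f g :
  cmeasurable f -> cmeasurable g -> cmeasurable (fun x => f x * g x).
Proof.
move=> [f1 f2] [g1 g2]; split.
- under eq_fun do rewrite Re_cM.
  by apply: measurable_funB; apply: measurable_funM.
- under eq_fun do rewrite Im_cM.
  by apply: measurable_funD; apply: measurable_funM.
Qed.

Lemma cmeasurableJ f : cmeasurable f -> cmeasurable (fun x => (f x)^*).
Proof.
move=> [f1 f2]; split.
  by rewrite (_ : (fun _ => _) = (fun x => complex.Re (f x)))//;
    apply/funext => x; case: (f x).
rewrite (_ : (fun _ => _) = (fun x => - complex.Im (f x))).
  exact: measurable_funN.
by apply/funext => x; case: (f x).
Qed.

Lemma measurable_normc f : cmeasurable f -> measurable_fun setT (fun x => normc (f x)).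
Proof.
move=> [f1 f2].
rewrite (_ : (fun _ => _) = (fun x => Num.sqrt (complex.Re (f x) ^+ 2 + complex.Im (f x) ^+ 2))).
  apply: (measurableT_comp (continuous_measurable_fun (@sqrt_continuous R))).
  by apply: measurable_funD; exact: measurable_funX.
by apply/funext => x; case: (f x).
Qed.

Variable mu : {measure set T -> \bar R}.

Definition cintegrable f :=
  mu.-integrable setT (EFin \o (fun x => complex.Re (f x))) /\
  mu.-integrable setT (EFin \o (fun x => complex.Im (f x))).

Definition cint f : R[i] :=
  Rintegral mu setT (fun x => complex.Re (f x)) +i*
  Rintegral mu setT (fun x => complex.Im (f x)).

Lemma cintegrable_measurable f : cintegrable f -> cmeasurable f.
Proof.
by move=> [/measurable_int/measurable_EFinP ? /measurable_int/measurable_EFinP ?].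
Qed.

Lemma cintegrable_le f (g : T -> R) : cmeasurable f ->
  mu.-integrable setT (EFin \o g) -> (forall x, normc (f x) <= g x) ->
  cintegrable f.
Proof.
move=> [f1 f2] ig fg; split.
- apply: (le_integrable measurableT _ _ ig); first exact/measurable_EFinP.
  move=> x _ /=; rewrite lee_fin; apply: le_trans (normr_Re_le _) _.
  exact: le_trans (fg x) (ler_norm _).
- apply: (le_integrable measurableT _ _ ig); first exact/measurable_EFinP.
  move=> x _ /=; rewrite lee_fin; apply: le_trans (normr_Im_le _) _.
  exact: le_trans (fg x) (ler_norm _).
Qed.

Lemma integrable_normc f : cintegrable f ->
  mu.-integrable setT (EFin \o (fun x => normc (f x))).
Proof.
move=> cf; have [f1 f2] := cf.
have i12 := integrableD measurableT (integrable_norm f1) (integrable_norm f2).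
apply: (le_integrable measurableT _ _ i12).
  exact/measurable_EFinP/measurable_normc/cintegrable_measurable.
move=> x _ /=; rewrite lee_fin.
rewrite ger0_norm ?normc_ge0// ger0_norm ?addr_ge0//.
exact: normc_le.
Qed.

Lemma cintegrableJ f : cintegrable f -> cintegrable (fun x => (f x)^*).
Proof.
move=> cf; apply: (cintegrable_le _ (integrable_normc cf)).
  exact/cmeasurableJ/cintegrable_measurable.
by move=> x; rewrite normcJ.
Qed.

Lemma integrable_mull (r : R) (u : T -> R) : mu.-integrable setT (EFin \o u) ->
  mu.-integrable setT (EFin \o (fun x => r * u x)).
Proof. by move=> iu; exact: (integrableZl measurableT r iu). Qed.

Lemma cintZ c f : cintegrable f -> cint (fun x => c * f x) = c * cint f.
Proof.
move=> [f1 f2]; apply/eqP; rewrite eq_complex; apply/andP; split; apply/eqP => /=.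
- under eq_Rintegral do rewrite Re_cM.
  rewrite RintegralB//; [|exact: integrable_mull..].
  by rewrite !RintegralZl// Re_cM.
- under eq_Rintegral do rewrite Im_cM.
  rewrite RintegralD//; [|exact: integrable_mull..].
  by rewrite !RintegralZl// Im_cM.
Qed.

Lemma cintJ f : cintegrable f -> cint (fun x => (f x)^*) = (cint f)^*.
Proof.
move=> [f1 f2]; apply/eqP; rewrite eq_complex; apply/andP; split; apply/eqP => /=.
  by apply: eq_Rintegral => x _; case: (f x).
rewrite -mulN1r -RintegralZl//.
by apply: eq_Rintegral => x _; case: (f x) => a b /=; rewrite mulN1r.
Qed.

Lemma eq_cint f g : f =1 g -> cint f = cint g.
Proof. by move=> /funext ->. Qed.

(** The factor 2 comes from treating the real and imaginary parts separately;
    the lemma serves for domination only, where it is harmless. *)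
Lemma normc_cint_le f : cintegrable f ->
  normc (cint f) <= 2 * Rintegral mu setT (fun x => normc (f x)).
Proof.
move=> cf; have [f1 f2] := cf; have nf := integrable_normc cf.
apply: le_trans (normc_le _) _; rewrite mulr2n mulrDl mul1r lerD//=.
- apply: le_trans (le_normr_Rintegral _ f1) _ => //.
  apply: le_Rintegral => //; first exact: integrable_norm.
  by move=> x _; exact: normr_Re_le.
- apply: le_trans (le_normr_Rintegral _ f2) _ => //.
  apply: le_Rintegral => //; first exact: integrable_norm.
  by move=> x _; exact: normr_Im_le.
Qed.

Lemma Rintegral_dominated (u_ : nat -> T -> R) (u g : T -> R) :
  (forall k, measurable_fun setT (u_ k)) -> measurable_fun setT u ->
  (forall x, u_ k x @[k --> \oo] --> u x) ->
  mu.-integrable setT (EFin \o g) -> (forall k x, `|u_ k x| <= g x) ->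
  Rintegral mu setT (u_ k) @[k --> \oo] --> Rintegral mu setT u.
Proof.
move=> mu_ mu1 u_u ig ug.
have [|||||iu _ cvu] := @dominated_convergence _ T R mu setT measurableT
  (fun k => EFin \o u_ k) (EFin \o u) (EFin \o g).
- by move=> k; exact/measurable_EFinP.
- exact/measurable_EFinP.
- by apply: aeW => x _; apply: cvg_EFin; [exact: nearW|exact: u_u].
- exact: ig.
- by apply: aeW => x k _ /=; rewrite lee_fin.
by apply: fine_cvg; rewrite fineK; [exact: cvu|exact: integrable_fin_num].
Qed.

Definition ccvg (z_ : nat -> R[i]) (z : R[i]) :=
  complex.Re (z_ k) @[k --> \oo] --> complex.Re z /\
  complex.Im (z_ k) @[k --> \oo] --> complex.Im z.

Lemma cint_dominated (f_ : nat -> T -> R[i]) f (g : T -> R) :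
  (forall k, cmeasurable (f_ k)) -> cmeasurable f ->
  (forall x, ccvg (f_ ^~ x) (f x)) ->
  mu.-integrable setT (EFin \o g) -> (forall k x, normc (f_ k x) <= g x) ->
  ccvg (fun k => cint (f_ k)) (cint f).
Proof.
move=> mf_ [f1 f2] f_f ig fg; split => /=.
- apply: (Rintegral_dominated (g := g)) => //.
  + by move=> k; case: (mf_ k).
  + by move=> x; case: (f_f x).
  + by move=> k x; exact: le_trans (normr_Re_le _) (fg k x).
- apply: (Rintegral_dominated (g := g)) => //.
  + by move=> k; case: (mf_ k).
  + by move=> x; case: (f_f x).
  + by move=> k x; exact: le_trans (normr_Im_le _) (fg k x).
Qed.

Lemma ccvg_unique z_ z w : ccvg z_ z -> ccvg z_ w -> z = w.
Proof.
move=> [z1 z2] [w1 w2]; apply/eqP; rewrite eq_complex; apply/andP; split; apply/eqP.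
- exact: cvg_unique z1 w1.
- exact: cvg_unique z2 w2.
Qed.

Lemma ccvgM x_ y_ x y : ccvg x_ x -> ccvg y_ y -> ccvg (fun k => x_ k * y_ k) (x * y).
Proof.
move=> [x1 x2] [y1 y2]; split.
- rewrite Re_cM; under eq_fun do rewrite Re_cM.
  by apply: cvgB; apply: cvgM.
- rewrite Im_cM; under eq_fun do rewrite Im_cM.
  by apply: cvgD; apply: cvgM.
Qed.

Lemma ccvg_cst z : ccvg (fun=> z) z.
Proof. by split; exact: cvg_cst. Qed.

End cintegral.

Lemma cmeasurable_comp d1 d2 (T1 : measurableType d1) (T2 : measurableType d2)
    (R : realType) (f : T2 -> R[i]) (S : T1 -> T2) :
  cmeasurable f -> measurable_fun setT S -> cmeasurable (f \o S).
Proof.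
move=> [f1 f2] mS; split.
- exact: (measurableT_comp f1 mS).
- exact: (measurableT_comp f2 mS).
Qed.

Section change_of_variables.
Context d1 d2 (T1 : measurableType d1) (T2 : measurableType d2) {R : realType}.
Variables (m1 : {measure set T1 -> \bar R}) (m2 : {measure set T2 -> \bar R}).
Variable (S : T1 -> T2).
Hypothesis mS : measurable_fun setT S.
Hypothesis SE : forall f : T2 -> \bar R,
  measurable_fun setT f -> (forall y, 0 <= f y)%E ->
  (\int[m2]_y f y = \int[m1]_x f (S x))%E.

Lemma cint_change (f : T2 -> R[i]) : cmeasurable f -> cint m2 f = cint m1 (f \o S).
Proof.
move=> [f1 f2]; congr (_ +i* _); rewrite /Rintegral (eq_integral_ge0 SE)//.
- exact/measurable_EFinP.
- exact/measurable_EFinP.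
Qed.

Lemma cintegrable_change (f : T2 -> R[i]) : cmeasurable f ->
  cintegrable m2 f <-> cintegrable m1 (f \o S).
Proof.
have H (u : T2 -> R) : measurable_fun setT u ->
    m2.-integrable setT (EFin \o u) <-> m1.-integrable setT (EFin \o (u \o S)).
  move=> mu; have muE : measurable_fun setT (EFin \o u) by exact/measurable_EFinP.
  have mabs : measurable_fun setT (fun y => `|(EFin \o u) y|%E).
    exact: measurableT_comp.
  split=> /integrableP[_ fi]; apply/integrableP; split => //.
  - exact: (measurableT_comp muE mS).
  - by rewrite (SE mabs) in fi.
  - by rewrite (SE mabs).
move=> [f1 f2]; split => -[i1 i2]; split.
- exact: (proj1 (H _ f1) i1).
- exact: (proj1 (H _ f2) i2).
- exact: (proj2 (H _ f1) i1).
- exact: (proj2 (H _ f2) i2).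
Qed.

End change_of_variables.

Section fubini_complex.
Context d1 d2 (T1 : measurableType d1) (T2 : measurableType d2) {R : realType}.
Variable m1 : {sigma_finite_measure set T1 -> \bar R}.
Variable m2 : {sigma_finite_measure set T2 -> \bar R}.
Notation normc := Normc.normc.

(** The inner integral is a real number only for almost every [x], whence the
    passage through almost-everywhere equality. *)
Lemma Rintegral_prod1 (u : T1 * T2 -> R) :
  (m1 \x m2)%E.-integrable setT (EFin \o u) ->
  Rintegral (m1 \x m2)%E setT u =
  Rintegral m1 setT (fun x => Rintegral m2 setT (fun y => u (x, y))).
Proof.
move=> iu; rewrite /Rintegral -(integral12_prod_meas1 iu); congr fine.
have mF := measurable_fubini_F iu.
apply: ae_eq_integral => //.
  apply/measurable_EFinP; apply: (measurableT_comp (f := fine)) => //.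
have := integrable_ae measurableT (integrable_fubini_F iu).
by apply: filterS => x /(_ I) fin _; rewrite -[LHS]fineK.
Qed.

Lemma Rintegral_prod2 (u : T1 * T2 -> R) :
  (m1 \x m2)%E.-integrable setT (EFin \o u) ->
  Rintegral (m1 \x m2)%E setT u =
  Rintegral m2 setT (fun y => Rintegral m1 setT (fun x => u (x, y))).
Proof.
move=> iu; rewrite /Rintegral -(integral21_prod_meas1 iu); congr fine.
have mF := measurable_fubini_G iu.
apply: ae_eq_integral => //.
  apply/measurable_EFinP; apply: (measurableT_comp (f := fine)) => //.
have := ae_integrable2 iu.
by apply: filterS => y iy _; rewrite -[LHS]fineK//; exact: integrable_fin_num.
Qed.

Lemma cint_prod1 (f : T1 * T2 -> R[i]) : cintegrable (m1 \x m2)%E f ->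
  cint (m1 \x m2)%E f = cint m1 (fun x => cint m2 (fun y => f (x, y))).
Proof. by move=> [f1 f2]; congr (_ +i* _); rewrite Rintegral_prod1. Qed.

Lemma cint_prod2 (f : T1 * T2 -> R[i]) : cintegrable (m1 \x m2)%E f ->
  cint (m1 \x m2)%E f = cint m2 (fun y => cint m1 (fun x => f (x, y))).
Proof. by move=> [f1 f2]; congr (_ +i* _); rewrite Rintegral_prod2. Qed.

(** The parameter of a Fourier transform ranges over a space of infinite measure,
    so the integrand is not jointly integrable; its positive and negative parts
    are treated separately by Tonelli's theorem. *)
Lemma measurable_Rintegral (u : T1 * T2 -> R) : measurable_fun setT u ->
  measurable_fun setT (fun x => Rintegral m2 setT (fun y => u (x, y))).
Proof.
move=> mu; apply: (measurableT_comp (f := fine)) => //.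
under eq_fun do rewrite integralE.
have mu' : measurable_fun setT (EFin \o u) by exact/measurable_EFinP.
apply: emeasurable_funB.
- rewrite (_ : (fun _ => _) = fubini_F m2 (EFin \o u)^\+%E).
    apply: measurable_fun_fubini_tonelli_F; last exact: funepos_ge0.
    exact: measurable_funepos.
  by apply/funext => x; apply: eq_integral => y _; rewrite !funeposE.
- rewrite (_ : (fun _ => _) = fubini_F m2 (EFin \o u)^\-%E).
    apply: measurable_fun_fubini_tonelli_F; last exact: funeneg_ge0.
    exact: measurable_funeneg.
  by apply/funext => x; apply: eq_integral => y _; rewrite !funenegE.
Qed.

Lemma cmeasurable_cint (f : T1 * T2 -> R[i]) : cmeasurable f ->
  cmeasurable (fun x => cint m2 (fun y => f (x, y))).
Proof.
by move=> [f1 f2]; split;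
  [exact: (measurable_Rintegral f1)|exact: (measurable_Rintegral f2)].
Qed.

Lemma integrable_prod (u : T1 -> R) (v : T2 -> R) :
  m1.-integrable setT (EFin \o u) -> m2.-integrable setT (EFin \o v) ->
  (m1 \x m2)%E.-integrable setT (EFin \o (fun p => u p.1 * v p.2)).
Proof.
move=> iu iv.
have mu := proj1 (measurable_EFinP _ _) (measurable_int _ iu).
have mv := proj1 (measurable_EFinP _ _) (measurable_int _ iv).
apply/integrable12ltyP.
  apply/measurable_EFinP/measurable_funM.
    exact: (measurableT_comp mu measurable_fst).
  exact: (measurableT_comp mv measurable_snd).
have vfin : (\int[m2]_y `|(v y)%:E| \is a fin_num)%E.
  by rewrite ge0_fin_numE ?integral_ge0//; case/integrableP : iv.
have mnv : measurable_fun setT (fun y => `|v y|%:E).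
  by apply/measurable_EFinP; exact: measurableT_comp.
have mnu : measurable_fun setT (fun x => `|u x|%:E).
  by apply/measurable_EFinP; exact: measurableT_comp.
have -> : (\int[m1]_x \int[m2]_y `|(EFin \o (fun p => (u p.1 * v p.2)%R)) (x, y)|
    = \int[m1]_x (`|u x|%:E * (fine (\int[m2]_y `|(v y)%:E|))%:E))%E.
  apply: eq_integral => x _; rewrite fineK// -ge0_integralZl//.
  by apply: eq_integral => y _ /=; rewrite normrM EFinM.
rewrite ge0_integralZr//; last by rewrite lee_fin fine_ge0// integral_ge0.
rewrite lte_mul_pinfty//; [exact: integral_ge0|..|exact: ltry].
by rewrite ge0_fin_numE ?integral_ge0//; case/integrableP : iu.
Qed.

Lemma cintegrable_prod (f : T1 -> R[i]) (g : T2 -> R[i]) :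
  cintegrable m1 f -> cintegrable m2 g ->
  cintegrable (m1 \x m2)%E (fun p => f p.1 * g p.2).
Proof.
move=> cf cg.
apply: (cintegrable_le _ (integrable_prod (integrable_normc cf) (integrable_normc cg))).
  apply: cmeasurableM.
    exact: (cmeasurable_comp (cintegrable_measurable cf) measurable_fst).
  exact: (cmeasurable_comp (cintegrable_measurable cg) measurable_snd).
by move=> p /=; rewrite Normc.normcM.
Qed.

Lemma cint_prod (f : T1 -> R[i]) (g : T2 -> R[i]) :
  cintegrable m1 f -> cintegrable m2 g ->
  cint (m1 \x m2)%E (fun p => f p.1 * g p.2) = cint m1 f * cint m2 g.
Proof.
move=> cf cg; rewrite cint_prod1; last exact: cintegrable_prod.
rewrite [RHS]mulrC -cintZ//; apply: eq_cint => x /=.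
by rewrite cintZ// mulrC.
Qed.

End fubini_complex.

(** * The Fourier transform of the exponential on the line *)

Section one_dimensional_kernels.
Context {R : realType}.
Notation mu := (@lebesgue_measure R).

Lemma integral_evenE (f : R -> R) (s : \bar R) : (forall x, 0 <= f x) ->
  continuous f -> (forall x, f (- x) = f x) ->
  (\int[mu]_(x in `[0%R, +oo[) (f x)%:E = s)%E ->
  (\int[mu]_x (f x)%:E = 2%:E * s)%E.
Proof.
move=> f0 cf fN <-; rewrite ge0_symfun_integralT//; last by move=> x /=.
by rewrite set_itvcy.
Qed.

Lemma integral_oneDsqrV : (\int[mu]_x ((1 + x ^+ 2)^-1)%:E = pi%:E)%E.
Proof.
rewrite (integral_evenE _ _ _ (integral0y_oneDsqr R)).
- by rewrite -EFinM mulrCA divff// mulr1.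
- by move=> x; rewrite invr_ge0 addr_ge0// sqr_ge0.
- exact: continuous_oneDsqrV.
- by move=> x; rewrite /oneDsqr sqrrN.
Qed.

Lemma integrable_oneDsqrV : mu.-integrable setT (EFin \o (fun x : R => (1 + x ^+ 2)^-1)).
Proof.
apply/integrableP; split.
  apply/measurable_EFinP.
  exact: (continuous_measurable_fun (@continuous_oneDsqrV R)).
rewrite (_ : integral _ _ _ = pi%:E) ?ltry// -integral_oneDsqrV.
apply: eq_integral => x _ /=.
by rewrite ger0_norm// invr_ge0 addr_ge0// sqr_ge0.
Qed.

(** The fundamental theorem of calculus on a half-line is applied to nonnegative
    integrands, so the constant [1] is added to the cosine; taking [c = 0] and
    [c = 1] and subtracting recovers the integral of the damped cosine. *)
Section damped_cosine.
Variables (a b c : R).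
Hypothesis a0 : 0 < a.
Hypothesis c1 : `|c| <= 1.

Let f x := expR (- a * `|x|) * (1 + c * cos (b * x)).
Let F x := - (expR (- a * x) / a)
  + c * (expR (- a * x) * (b * sin (b * x) - a * cos (b * x)) / (a ^+ 2 + b ^+ 2)).

Let ab0 : a ^+ 2 + b ^+ 2 != 0.
Proof. by rewrite gt_eqF// ltr_wpDr ?sqr_ge0// exprn_gt0. Qed.

Let cf : continuous f.
Proof.
move=> x; apply: cvgM.
  apply: (continuous_comp (f := fun x => - a * `|x|)); last exact: continuous_expR.
  by apply: cvgM; [exact: cvg_cst|exact: norm_continuous].
apply: cvgD; first exact: cvg_cst.
apply: cvgM; first exact: cvg_cst.
apply: (continuous_comp (f := fun x => b * x)); last exact: continuous_cos.
exact: mulrl_continuous.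
Qed.

Let dF x : is_derive x (1 : R) F (expR (- a * x) * (1 + c * cos (b * x))).
Proof.
have dk (k : R) : is_derive x (1 : R) (fun y => k * y) k.
  by apply: is_derive_eq; rewrite /GRing.scale/= mulr1.
have dE : is_derive x (1 : R) (fun y => expR (- a * y)) (expR (- a * x) * - a).
  exact: (is_derive1_comp (is_derive_expR _) (dk _)).
have dS : is_derive x (1 : R) (fun y => sin (b * y)) (cos (b * x) * b).
  exact: (is_derive1_comp (is_derive_sin _) (dk _)).
have dC : is_derive x (1 : R) (fun y => cos (b * y)) (- sin (b * x) * b).
  exact: (is_derive1_comp (is_derive_cos _) (dk _)).
apply: is_derive_eq; rewrite /GRing.scale/=.
by field; rewrite ab0 gt_eqF.
Qed.

Let cvgE : expR (- a * x) @[x --> +oo] --> (0 : R).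
Proof.
under eq_fun do rewrite mulNr.
apply: (cvg_comp (fun x => a * x) (fun x => expR (- x)) _ (@cvgr_expR R)).
by apply: gt0_cvgMry => //; exact: cvg_id.
Qed.

Let cvgF : F x @[x --> +oo] --> (0 : R).
Proof.
pose M := a^-1 + (`|b| + a) / (a ^+ 2 + b ^+ 2).
have FM x : `|F x| <= M * expR (- a * x).
  rewrite (_ : F x = (- a^-1 + c * ((b * sin (b * x) - a * cos (b * x)) / (a ^+ 2 + b ^+ 2)))
    * expR (- a * x)); last first.
    by rewrite /F; field; rewrite ab0 gt_eqF.
  rewrite normrM (ger0_norm (expR_ge0 _)) ler_wpM2r ?expR_ge0//.
  rewrite (le_trans (ler_normD _ _))// normrN ger0_norm ?invr_ge0 ?(ltW a0)//.
  rewrite lerD2l normrM -[leRHS]mul1r ler_pM// normrM ler_pM//.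
    rewrite (le_trans (ler_normB _ _))// !normrM lerD//.
      by rewrite ler_piMr// sin_max.
    by rewrite gtr0_norm// ler_piMr ?(ltW a0)// cos_max.
  by rewrite ger0_norm// invr_ge0 addr_ge0 ?sqr_ge0.
have cM : M * expR (- a * x) @[x --> +oo] --> (0 : R).
  by rewrite -(mulr0 M); apply: cvgM; [exact: cvg_cst|exact: cvgE].
apply: (@squeeze_cvgr _ _ _ _ (fun x => - (M * expR (- a * x))) (fun x => M * expR (- a * x))).
- by near=> x; rewrite -ler_norml.
- by rewrite -oppr0; exact: cvgN.
- exact: cM.
Unshelve. all: by end_near. Qed.

Lemma integral_damped_cosine :
  (\int[mu]_x (expR (- a * `|x|) * (1 + c * cos (b * x)))%:E
   = (2 * (a^-1 + c * (a / (a ^+ 2 + b ^+ 2))))%:E)%E.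
Proof.
have f0 x : 0 <= f x.
  rewrite mulr_ge0 ?expR_ge0// -lerBlDl sub0r.
  have : `|c * cos (b * x)| <= 1 by rewrite normrM mulr_ile1// cos_max.
  by rewrite ler_norml => /andP[].
rewrite (integral_evenE (s := (a^-1 + c * (a / (a ^+ 2 + b ^+ 2)))%:E))//.
- by move=> x; rewrite /f normrN mulrN cosN.
have fE x : 0 <= x -> f x = expR (- a * x) * (1 + c * cos (b * x)).
  by move=> x0; rewrite /f ger0_norm.
have dF' x : derivable F x 1 by have [] := dF x.
rewrite (@ge0_continuous_FTC2y _ f F 0 0)//.
- rewrite /F !mulr0 expR0 sin0 cos0 -EFinB; congr EFin.
  by field; rewrite ab0 gt_eqF.
- exact: continuous_subspaceT.
- apply: cvg_at_right_filter.
  exact/differentiable_continuous/derivable1_diffP.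
- move=> x; rewrite in_itv/= andbT => x0.
  by rewrite derive1E (@derive_val _ _ _ _ _ _ _ (dF x)) fE// ltW.
Qed.

End damped_cosine.

Lemma integrable_damping (a : R) : 0 < a ->
  mu.-integrable setT (EFin \o (fun x => expR (- a * `|x|))).
Proof.
move=> a0; apply/integrableP; split.
  apply/measurable_EFinP; apply: measurableT_comp => //.
  exact: measurable_funM.
have := @integral_damped_cosine a 0 0 a0; rewrite normr0 => /(_ ler01) H.
rewrite (_ : integral _ _ _ = (2 * (a^-1 + 0 * (a / (a ^+ 2 + 0 ^+ 2))))%:E) ?ltry// -H.
apply: eq_integral => x _ /=.
by rewrite ger0_norm ?expR_ge0// mul0r addr0 mulr1.
Qed.

(** The Poisson kernel of the upper half-plane. *)
Definition poisson1 (e u : R) : R := e / (pi * (e ^+ 2 + u ^+ 2)).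

Lemma Rintegral_odd (f : R -> R) : mu.-integrable setT (EFin \o f) ->
  (forall x, f (- x) = - f x) -> Rintegral mu setT f = 0.
Proof.
move=> intf fN.
have mf := proj1 (measurable_EFinP _ _) (measurable_int _ intf).
have H : Rintegral mu setT f = Rintegral mu setT (fun x => - f x).
  rewrite /Rintegral (@eq_integral_ge0 _ _ _ _ R mu mu -%R)//.
  - by under eq_integral do rewrite /= fN.
  - move=> g mg g0; rewrite (@ge0_integral_affine R (-1) 0)// ?oppr_eq0 ?oner_eq0//.
    rewrite normrN1 mul1e; apply: eq_integral => x _.
    by rewrite mulN1r addr0.
  - exact/measurable_EFinP.
have : Rintegral mu setT f = - Rintegral mu setT f.
  rewrite {1}H -mulN1r -RintegralZl//.
  by apply: eq_Rintegral => x _; rewrite mulN1r.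
by move=> /eqP; rewrite -subr_eq0 opprK -mulr2n mulrn_eq0/= => /eqP.
Qed.

(** The imaginary part vanishes by parity. *)
Lemma cint_damping (e u : R) : 0 < e ->
  cintegrable mu (fun w => (expR (- (2 * pi * e) * `|w|))%:C * cis2pi (u * w)) /\
  cint mu (fun w => (expR (- (2 * pi * e) * `|w|))%:C * cis2pi (u * w))
    = (poisson1 e u)%:C.
Proof.
move=> e0; set a := 2 * pi * e; set b := 2 * pi * u.
have a0 : 0 < a by rewrite !mulr_gt0// pi_gt0.
have iE := integrable_damping a0.
have fE w : (expR (- a * `|w|))%:C * cis2pi (u * w)
    = (expR (- a * `|w|) * cos (b * w)) +i* (expR (- a * `|w|) * sin (b * w)).
  by rewrite /cis2pi /b mulrA; simpc.
have mE : measurable_fun setT (fun w : R => expR (- a * `|w|)).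
  exact: (proj1 (measurable_EFinP _ _) (measurable_int _ iE)).
have mc : measurable_fun setT (fun w : R => cos (b * w)).
  apply: (measurableT_comp (continuous_measurable_fun (@continuous_cos R))).
  exact: mulrl_measurable.
have ms : measurable_fun setT (fun w : R => sin (b * w)).
  apply: (measurableT_comp (continuous_measurable_fun (@continuous_sin R))).
  exact: mulrl_measurable.
have iC : mu.-integrable setT (EFin \o (fun w => expR (- a * `|w|) * cos (b * w))).
  apply: (le_integrable measurableT _ _ iE).
    by apply/measurable_EFinP/measurable_funM.
  by move=> w _; rewrite /= lee_fin normrM ler_piMr// cos_max.
have iS : mu.-integrable setT (EFin \o (fun w => expR (- a * `|w|) * sin (b * w))).
  apply: (le_integrable measurableT _ _ iE).
    by apply/measurable_EFinP/measurable_funM.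
  by move=> w _; rewrite /= lee_fin normrM ler_piMr// sin_max.
rewrite (_ : (fun _ => _) = fun w => (expR (- a * `|w|) * cos (b * w)) +i* (expR (- a * `|w|) * sin (b * w))); last exact/funext.
split; first by split.
congr (_ +i* _) => /=; last first.
  by apply: Rintegral_odd => // w; rewrite normrN mulrN sinN mulrN.
have : Rintegral mu setT (fun w => expR (- a * `|w|) + expR (- a * `|w|) * cos (b * w))
    = 2 * (a^-1 + 1 * (a / (a ^+ 2 + b ^+ 2))).
  rewrite /Rintegral -[RHS]/(fine (_%:E)) -(@integral_damped_cosine a b 1)// ?normr1//.
  by congr fine; apply: eq_integral => w _; rewrite mul1r mulrDr mulr1.
have : Rintegral mu setT (fun w => expR (- a * `|w|)) = 2 * (a^-1 + 0 * (a / (a ^+ 2 + b ^+ 2))).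
  rewrite /Rintegral -[RHS]/(fine (_%:E)) -(@integral_damped_cosine a b 0)// ?normr0//.
  by congr fine; apply: eq_integral => w _; rewrite mul0r addr0 mulr1.
rewrite RintegralD// => -> /(canRL (addKr _)) ->.
have p0 : pi != 0 :> R by rewrite gt_eqF// pi_gt0.
have eu : e ^+ 2 + u ^+ 2 != 0 by rewrite gt_eqF// ltr_wpDr ?sqr_ge0// exprn_gt0.
rewrite /poisson1 /a /b; move: p0; generalize (pi : R) => p p0.
field; rewrite eu p0 (gt_eqF e0)/=.
rewrite (_ : _ + _ = (2 * p) ^+ 2 * (e ^+ 2 + u ^+ 2)); last by ring.
by rewrite mulf_neq0// expf_neq0// mulf_neq0.
Qed.

Lemma integrable_poisson1 : mu.-integrable setT (EFin \o poisson1 1).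
Proof.
have -> : poisson1 1 = (fun x => pi^-1 * (1 + x ^+ 2)^-1).
  by apply/funext => x; rewrite /poisson1 expr1n mul1r invfM.
exact/integrable_mull/integrable_oneDsqrV.
Qed.

Lemma Rintegral_poisson1 : Rintegral mu setT (poisson1 1) = 1.
Proof.
have -> : poisson1 1 = (fun x => pi^-1 * (1 + x ^+ 2)^-1).
  by apply/funext => x; rewrite /poisson1 expr1n mul1r invfM.
rewrite RintegralZl//; last exact: integrable_oneDsqrV.
by rewrite /Rintegral integral_oneDsqrV/= mulVf// gt_eqF// pi_gt0.
Qed.

End one_dimensional_kernels.

(** * Product kernels in dimension n *)

Section products.
Context {R : realType}.
Notation mu := (@lebesgue_measure R).
Notation normc := Normc.normc.

Lemma cmeasurable_bigprod d (T : measurableType d) (I : Type) (r : seq I)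
    (h : I -> T -> R[i]) :
  (forall i, cmeasurable (h i)) -> cmeasurable (fun x => \prod_(i <- r) h i x).
Proof.
move=> mh; elim: r => [|i r IH].
  by under eq_fun do rewrite big_nil; exact: cmeasurable_cst.
by under eq_fun do rewrite big_cons; exact: cmeasurableM.
Qed.

Lemma cint_bigprod n (h : 'I_n -> R -> R[i]) : (forall i, cintegrable mu (h i)) ->
  cintegrable (lebesgue_rv n) (fun x : 'rV[R]_n => \prod_i h i (x 0 i)) /\
  cint (lebesgue_rv n) (fun x : 'rV[R]_n => \prod_i h i (x 0 i)) = \prod_i cint mu (h i).
Proof.
elim: n h => [|n IH] h ih.
  have fE : (fun x : 'rV[R]_0 => \prod_(i < 0) h i (x 0 i)) = fun=> 1.
    by apply/funext => x; rewrite big_ord0.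
  have rE (c : R) : Rintegral (@lebesgue_rv R 0) setT (fun=> c) = c.
    by rewrite /Rintegral integral_lebesgue_rv0//; exact: measurable_cst.
  have iE (c : R) : (@lebesgue_rv R 0).-integrable setT (EFin \o (fun=> c)).
    apply/integrableP; split; first exact: measurable_cst.
    by rewrite integral_lebesgue_rv0/= ?ltry//; exact: measurable_cst.
  rewrite fE big_ord0; split; first by split; exact: iE.
  by rewrite /cint !rE.
have mprod m (g : 'I_m -> R -> R[i]) : (forall i, cintegrable mu (g i)) ->
    cmeasurable (fun x : 'rV[R]_m => \prod_i g i (x 0 i)).
  move=> ig; apply: cmeasurable_bigprod => i.
  exact: (cmeasurable_comp (cintegrable_measurable (ig i)) (measurable_rv_coord i)).
have SE f : measurable_fun setT f -> (forall y, 0 <= f y)%E ->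
    (\int[lebesgue_rv n.+1]_y f y = \int[mu \x lebesgue_rv n]_p f (cons_rv p))%E.
  by move=> mf _; exact: integral_lebesgue_rvS.
have [icons cintcons] := IH (fun i => h (lift ord0 i)) (fun i => ih (lift ord0 i)).
have hE : (fun x : 'rV[R]_n.+1 => \prod_i h i (x 0 i)) \o (@cons_rv R n) =
    fun p => h ord0 p.1 * (\prod_i h (lift ord0 i) (p.2 0 i)).
  apply/funext => p /=; rewrite big_ord_recl cons_rv0; congr (_ * _).
  by apply: eq_bigr => i _; rewrite cons_rvS.
split.
  apply: (proj2 (cintegrable_change (@measurable_cons_rv R n) SE (mprod _ _ ih))).
  by rewrite hE; exact: (cintegrable_prod (ih ord0) icons).
rewrite (cint_change SE (mprod _ _ ih)) hE (cint_prod (ih ord0) icons).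
by rewrite big_ord_recl cintcons.
Qed.

Lemma integrable_bigprod n (h : 'I_n -> R -> R) :
  (forall i, mu.-integrable setT (EFin \o h i)) ->
  (lebesgue_rv n).-integrable setT (EFin \o (fun x : 'rV[R]_n => \prod_i h i (x 0 i))) /\
  Rintegral (lebesgue_rv n) setT (fun x : 'rV[R]_n => \prod_i h i (x 0 i))
    = \prod_i Rintegral mu setT (h i).
Proof.
move=> ih.
have ich i : cintegrable mu (fun x => (h i x)%:C).
  by split => //=; exact: integrable0.
have [[i1 _] cE] := cint_bigprod ich.
have hE (x : 'rV[R]_n) : \prod_i (h i (x 0 i))%:C = (\prod_i h i (x 0 i))%:C.
  by rewrite rmorph_prod.
have cE' i : cint mu (fun x => (h i x)%:C) = (Rintegral mu setT (h i))%:C.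
  by congr (_ +i* _); rewrite /Rintegral integral0.
split.
  by move: i1; under eq_fun do rewrite hE.
move: cE; under eq_bigr do rewrite cE'.
rewrite -rmorph_prod => /(congr1 (@complex.Re R)) /= <-.
by apply: eq_Rintegral => x _; rewrite hE.
Qed.

Lemma cis2piD (s t : R) : cis2pi (s + t) = cis2pi s * cis2pi t.
Proof. by rewrite /cis2pi mulrDr cosD sinD; simpc; congr (_ +i* _); rewrite addrC. Qed.

Lemma cis2pi0 : cis2pi (0 : R) = 1.
Proof. by rewrite /cis2pi mulr0 cos0 sin0. Qed.

Lemma cis2piN (s : R) : cis2pi (- s) = (cis2pi s)^*.
Proof. by rewrite /cis2pi mulrN cosN sinN. Qed.

Lemma normc_cis2pi (s : R) : normc (cis2pi s) = 1.
Proof. by rewrite /= cos2Dsin2 sqrtr1. Qed.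

Lemma cis2pi_dot n (u w : 'rV[R]_n) : cis2pi (dot u w) = \prod_i cis2pi (u 0 i * w 0 i).
Proof. by rewrite /dot (big_morph _ cis2piD cis2pi0). Qed.

Lemma measurable_cis2pi d (T : measurableType d) (u : T -> R) :
  measurable_fun setT u -> cmeasurable (fun x => cis2pi (u x)).
Proof.
move=> mu'; split => /=.
- apply: (measurableT_comp (continuous_measurable_fun (@continuous_cos R))).
  exact: measurable_funM.
- apply: (measurableT_comp (continuous_measurable_fun (@continuous_sin R))).
  exact: measurable_funM.
Qed.

Lemma measurable_dot d (T : measurableType d) n (x y : T -> 'rV[R]_n) :
  measurable_fun setT x -> measurable_fun setT y ->
  measurable_fun setT (fun t => dot (x t) (y t)).
Proof.
move=> mx my; apply: measurable_sum => i.
apply: measurable_funM.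
- exact: (measurableT_comp (measurable_rv_coord i) mx).
- exact: (measurableT_comp (measurable_rv_coord i) my).
Qed.

Section dimension.
Variable n : nat.
Implicit Types (e : R) (u v w x : 'rV[R]_n).

Definition damping e w : R := \prod_i expR (- (2 * pi * e) * `|w 0 i|).
Definition poisson e u : R := \prod_i poisson1 e (u 0 i).
Definition decay x : R := \prod_i (1 + x 0 i ^+ 2)^-1.

Lemma damping_ge0 e w : 0 <= damping e w.
Proof. by apply: prodr_ge0 => i _; exact: expR_ge0. Qed.

Lemma damping_le1 e w : 0 <= e -> damping e w <= 1.
Proof.
move=> e0; apply: numdomain.Num.Theory.prodr_ile1 => i _; rewrite expR_ge0 -expR0 ler_expR mulNr oppr_le0.
by rewrite !mulr_ge0// pi_ge0.
Qed.

Lemma le_damping e e' w : e <= e' -> damping e' w <= damping e w.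
Proof.
move=> ee'; apply: ler_prod => i _; rewrite expR_ge0 ler_expR !mulNr lerN2.
by rewrite ler_wpM2r// ler_wpM2l// mulr_ge0// pi_ge0.
Qed.

Lemma damping_cvg w : damping k.+1%:R^-1 w @[k --> \oo] --> (1 : R).
Proof.
have c0 : damping e w @[e --> (0 : R)] --> (1 : R).
  have <- : damping 0 w = 1.
    by rewrite /damping big1// => i _; rewrite mulr0 oppr0 mul0r expR0.
  have : continuous (fun e => \prod_(i <- index_enum 'I_n) expR (- (2 * pi * e) * `|w 0 i|)).
    elim: (index_enum _) => [|i r IH] e.
      by under eq_fun do rewrite big_nil; exact: cvg_cst.
    under eq_fun do rewrite big_cons.
    apply: cvgM; last exact: IH.
    apply: (continuous_comp (f := fun e => - (2 * pi * e) * `|w 0 i|)); last exact: continuous_expR.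
    apply: cvgM; last exact: cvg_cst.
    by apply: cvgN; exact: mulrl_continuous.
  exact.
exact: (cvg_comp _ _ cvg_harmonic c0).
Qed.

Lemma cint_damping_rv e u : 0 < e ->
  cintegrable (lebesgue_rv n) (fun w => (damping e w)%:C * cis2pi (dot u w)) /\
  cint (lebesgue_rv n) (fun w => (damping e w)%:C * cis2pi (dot u w)) = (poisson e u)%:C.
Proof.
move=> e0.
have [i c] := cint_bigprod (fun i => proj1 (cint_damping (u 0 i) e0)).
have hE w : (damping e w)%:C * cis2pi (dot u w) =
    \prod_i ((expR (- (2 * pi * e) * `|w 0 i|))%:C * cis2pi (u 0 i * w 0 i)).
  by rewrite /damping rmorph_prod cis2pi_dot -big_split.
split; first by under eq_fun do rewrite hE.
rewrite (eq_cint _ hE) c /poisson rmorph_prod.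
by apply: eq_bigr => j _; exact: (proj2 (cint_damping (u 0 j) e0)).
Qed.

Lemma integrable_damping_rv e : 0 < e ->
  (lebesgue_rv n).-integrable setT (EFin \o damping e).
Proof.
move=> e0; have a0 : 0 < 2 * pi * e by rewrite !mulr_gt0// pi_gt0.
exact: (proj1 (integrable_bigprod (fun i : 'I_n => integrable_damping a0))).
Qed.

Lemma integrable_poisson : (lebesgue_rv n).-integrable setT (EFin \o poisson 1).
Proof.
exact: (proj1 (integrable_bigprod (fun i : 'I_n => @integrable_poisson1 R))).
Qed.

Lemma Rintegral_poisson : Rintegral (lebesgue_rv n) setT (poisson 1) = 1.
Proof.
rewrite [LHS](proj2 (integrable_bigprod (fun i : 'I_n => @integrable_poisson1 R))).
by rewrite big1// => i _; exact: Rintegral_poisson1.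
Qed.

Lemma integrable_decay : (lebesgue_rv n).-integrable setT (EFin \o decay).
Proof.
exact: (proj1 (integrable_bigprod (fun i : 'I_n => @integrable_oneDsqrV R))).
Qed.

Lemma poisson_ge0 v : 0 <= poisson 1 v.
Proof.
apply: prodr_ge0 => i _.
by rewrite /poisson1 divr_ge0// mulr_ge0 ?pi_ge0// addr_ge0// sqr_ge0.
Qed.

(** Scaling shows that the kernels [poisson e] form an approximate identity. *)
Lemma poissonZ e v : 0 < e -> e ^+ n * poisson e (e *: v) = poisson 1 v.
Proof.
move=> e0; rewrite /poisson -{1}(card_ord n) -prodr_const -big_split/=.
apply: eq_bigr => i _; rewrite mxE /poisson1.
move: (pi_gt0 R) => /lt0r_neq0; generalize (pi : R) => p p0.
have v0 : 1 + v 0 i ^+ 2 != 0 by rewrite gt_eqF// ltr_wpDr// sqr_ge0.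
have ev0 : e ^+ 2 + (e * v 0 i) ^+ 2 != 0.
  by rewrite exprMn -{1}[e ^+ 2]mulr1 -mulrDr mulf_neq0// expf_neq0// gt_eqF.
by field; rewrite v0 p0.
Qed.

End dimension.
End products.

Local Arguments conjc : simpl never.
Local Arguments cis2pi : simpl never.

(** * Parseval's identity, damped form *)

Section parseval.
Context {R : realType} {n : nat}.
Notation normc := Normc.normc.
Notation leb := (@lebesgue_rv R n).
Implicit Types (F K : 'rV[R]_n -> R[i]).

Lemma measurable_affine_rv (a : R) (b : 'rV[R]_n) :
  measurable_fun setT (fun x : 'rV[R]_n => a *: x + b).
Proof.
apply: measurable_fun_rvP => i.
under eq_fun do rewrite !mxE.
apply: measurable_funD => //.
by apply: measurable_funM => //; exact: measurable_rv_coord.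
Qed.

Lemma Rintegral_affine_rv (a : R) (b : 'rV[R]_n) (u : 'rV[R]_n -> R) : a != 0 ->
  leb.-integrable setT (EFin \o u) ->
  leb.-integrable setT (EFin \o (fun x => u (a *: x + b))) /\
  Rintegral leb setT u = `|a| ^+ n * Rintegral leb setT (fun x => u (a *: x + b)).
Proof.
move=> a0 /[dup] iu /integrableP[mu ifin].
have mS := measurable_affine_rv a b.
have c0 : (0 < (`|a| ^+ n)%:E)%E by rewrite lte_fin exprn_gt0// normr_gt0.
have iuS : leb.-integrable setT (EFin \o (fun x => u (a *: x + b))).
  apply/integrableP; split; first exact: (measurableT_comp mu mS).
  rewrite ltey; apply: contraTneq ifin => ioo; rewrite -leNgt.
  rewrite (ge0_integral_rv_affine b a0)//; last exact: measurableT_comp.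
  by rewrite /= in ioo; rewrite /= ioo gt0_muley.
split=> //; rewrite /Rintegral integralE [in RHS]integralE.
have fp := integrable_pos_fin_num measurableT iuS.
have fn := integrable_neg_fin_num measurableT iuS.
have -> : (\int[leb]_x (EFin \o u)^\+%E x
    = (`|a| ^+ n)%:E * \int[leb]_x (EFin \o (fun x => u (a *: x + b)%R))^\+%E x)%E.
  rewrite (ge0_integral_rv_affine b a0 (measurable_funepos mu))//.
  by congr (_ * _)%E; apply: eq_integral => x _; rewrite !funeposE.
have -> : (\int[leb]_x (EFin \o u)^\-%E x
    = (`|a| ^+ n)%:E * \int[leb]_x (EFin \o (fun x => u (a *: x + b)%R))^\-%E x)%E.
  rewrite (ge0_integral_rv_affine b a0 (measurable_funeneg mu))//.
  by congr (_ * _)%E; apply: eq_integral => x _; rewrite !funenegE.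
rewrite -muleBr//; last exact: (fin_num_adde_defr _ fp).
by rewrite fineM// fin_numB fp fn.
Qed.

Lemma cint_affine_rv (a : R) (b : 'rV[R]_n) F : a != 0 -> cintegrable leb F ->
  cintegrable leb (fun x => F (a *: x + b)) /\
  cint leb F = (`|a| ^+ n)%:C * cint leb (fun x => F (a *: x + b)).
Proof.
move=> a0 [F1 F2].
have [iF1 E1] := Rintegral_affine_rv b a0 F1.
have [iF2 E2] := Rintegral_affine_rv b a0 F2.
split; first by split.
by rewrite /cint E1 E2; simpc.
Qed.

Definition fourier F (w : 'rV[R]_n) : R[i] :=
  cint leb (fun t => cis2pi (- dot t w) * F t).

(** Boundedness and continuity make the convolution with an approximate identity
    converge pointwise and boundedly. *)
Definition tame F :=
  [/\ continuous (fun x => complex.Re (F x)), continuous (fun x => complex.Im (F x)),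
      cintegrable leb F & exists M : R, forall x, normc (F x) <= M].

Lemma tame_measurable F : tame F -> cmeasurable F.
Proof. by move=> [_ _ iF _]; exact: cintegrable_measurable iF. Qed.

Lemma measurable_dotr (w : 'rV[R]_n) : measurable_fun setT (fun t : 'rV[R]_n => dot t w).
Proof. by apply: measurable_dot => //; exact: measurable_id. Qed.

Lemma cmeasurable_character (w : 'rV[R]_n) :
  cmeasurable (fun t : 'rV[R]_n => cis2pi (- dot t w)).
Proof.
apply: measurable_cis2pi; apply: measurableT_comp => //; exact: measurable_dotr.
Qed.

Lemma cintegrable_mull_le1 F (c : 'rV[R]_n -> R[i]) :
  cmeasurable c -> (forall t, normc (c t) <= 1) ->
  cintegrable leb F -> cintegrable leb (fun t => c t * F t).
Proof.
move=> mc c1 iF; apply: (cintegrable_le _ (integrable_normc iF)).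
  by apply: cmeasurableM => //; exact: cintegrable_measurable iF.
by move=> t; rewrite Normc.normcM ler_piMl// normc_ge0.
Qed.

Lemma cmeasurable_fourier F : cmeasurable F -> cmeasurable (fourier F).
Proof.
move=> mF.
apply: (@cmeasurable_cint _ _ _ _ R leb
  (fun p : 'rV[R]_n * 'rV[R]_n => cis2pi (- dot p.2 p.1) * F p.2)).
apply: cmeasurableM.
  apply: measurable_cis2pi; apply: measurableT_comp => //.
  by apply: measurable_dot.
exact: (cmeasurable_comp mF measurable_snd).
Qed.

Lemma normc_fourier_le F w : cintegrable leb F ->
  normc (fourier F w) <= 2 * Rintegral leb setT (fun t => normc (F t)).
Proof.
move=> iF; apply: le_trans (normc_cint_le _) _.
  apply: cintegrable_mull_le1 => //; first exact: cmeasurable_character.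
  by move=> t; rewrite normc_cis2pi.
by under eq_Rintegral do rewrite Normc.normcM normc_cis2pi mul1r.
Qed.

Lemma fourierJ F w : cintegrable leb F ->
  (fourier F w)^* = cint leb (fun t => cis2pi (dot t w) * (F t)^*).
Proof.
move=> iF; rewrite -cintJ.
  by apply: eq_cint => t; rewrite conjcM -cis2piN opprK.
apply: cintegrable_mull_le1 => //; first exact: cmeasurable_character.
by move=> t; rewrite normc_cis2pi.
Qed.

Section damped_parseval.
Variables (F K : 'rV[R]_n -> R[i]).
Hypotheses (iF : cintegrable leb F) (iK : cintegrable leb K).

(** The damping factor makes the integrand absolutely integrable in the frequency
    and the space variable of [F] jointly, so that Fubini's theorem applies. *)
Lemma cint_damped_fourier_prod (e : R) : 0 < e ->
  cint leb (fun w => (damping e w)%:C * (fourier F w * (fourier K w)^*)) =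
  cint leb (fun s => F s * cint leb (fun w =>
    (damping e w)%:C * cis2pi (- dot s w) * (fourier K w)^*)).
Proof.
move=> e0.
have mF := cintegrable_measurable iF.
have mD : measurable_fun setT (@damping R n e).
  exact: (proj1 (measurable_EFinP _ _) (measurable_int _ (@integrable_damping_rv R n e e0))).
have mK := cmeasurableJ (cmeasurable_fourier (cintegrable_measurable iK)).
pose B := 2 * Rintegral leb setT (fun t => normc (K t)).
have B0 : 0 <= B by rewrite mulr_ge0// Rintegral_ge0// => x _; exact: normc_ge0.
pose Phi (p : 'rV[R]_n * 'rV[R]_n) :=
  (damping e p.1)%:C * (fourier K p.1)^* * (cis2pi (- dot p.2 p.1) * F p.2).
have iPhi : cintegrable (leb \x leb)%E Phi.
  have ig := integrable_prod (integrable_mull B (@integrable_damping_rv R n e e0))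
    (integrable_normc iF).
  apply: (cintegrable_le _ ig).
    apply: cmeasurableM; first apply: cmeasurableM.
    - exact: (cmeasurable_real (measurableT_comp mD measurable_fst)).
    - exact: (cmeasurable_comp mK measurable_fst).
    - apply: cmeasurableM; last exact: (cmeasurable_comp mF measurable_snd).
      apply: measurable_cis2pi; apply: measurableT_comp => //.
      exact: measurable_dot.
  move=> p; rewrite /Phi !Normc.normcM normc_cis2pi mul1r normc_real normcJ.
  rewrite ler_wpM2r ?normc_ge0// mulrC ger0_norm ?damping_ge0//.
  by rewrite ler_wpM2r ?damping_ge0//; exact: normc_fourier_le.
transitivity (cint (leb \x leb)%E Phi).
  rewrite cint_prod1//; apply: eq_cint => w.
  rewrite /Phi/= cintZ; first by rewrite -/(fourier F w) mulrA mulrAC.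
  apply: cintegrable_mull_le1 => //; first exact: cmeasurable_character.
  by move=> t; rewrite normc_cis2pi.
rewrite cint_prod2//; apply: eq_cint => s; rewrite -cintZ.
  by apply: eq_cint => w; rewrite /Phi/=; ring.
apply: (cintegrable_le _ (integrable_mull B (@integrable_damping_rv R n e e0))).
  apply: cmeasurableM => //; apply: cmeasurableM; first exact: cmeasurable_real.
  apply: measurable_cis2pi; apply: measurableT_comp => //.
  by apply: measurable_dot => //; exact: measurable_cst.
move=> w; rewrite !Normc.normcM normc_cis2pi mulr1 normc_real normcJ mulrC.
by rewrite ger0_norm ?damping_ge0// ler_wpM2r ?damping_ge0//; exact: normc_fourier_le.
Qed.

(** After a second exchange of integrals, the frequency integral of the damping
    factor against the characters is [poisson e (t - s)]; the substitution
    [t = e *: v + s] then moves the dependence on [e] from the kernel to [K]. *)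
Lemma cint_damped_fourier (e : R) (s : 'rV[R]_n) : 0 < e ->
  cint leb (fun w => (damping e w)%:C * cis2pi (- dot s w) * (fourier K w)^*) =
  cint leb (fun v => (poisson 1 v)%:C * (K (e *: v + s))^*).
Proof.
move=> e0.
have mD : measurable_fun setT (@damping R n e).
  exact: (proj1 (measurable_EFinP _ _) (measurable_int _ (@integrable_damping_rv R n e e0))).
have mK := cintegrable_measurable iK.
have iKJ := cintegrableJ iK.
pose Psi (p : 'rV[R]_n * 'rV[R]_n) :=
  (damping e p.1)%:C * cis2pi (dot (p.2 - s) p.1) * (K p.2)^*.
have mPsi : cmeasurable Psi.
  apply: cmeasurableM; last exact: (cmeasurable_comp (cmeasurableJ mK) measurable_snd).
  apply: cmeasurableM.
    exact: (cmeasurable_real (measurableT_comp mD measurable_fst)).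
  apply: measurable_cis2pi; apply: measurable_dot => //.
  rewrite (_ : (fun _ => _) = (fun x : 'rV[R]_n => 1 *: x + - s) \o snd).
    exact: (measurableT_comp (measurable_affine_rv _ _) measurable_snd).
  by apply/funext => p /=; rewrite scale1r.
have iPsi : cintegrable (leb \x leb)%E Psi.
  have ig := integrable_prod (@integrable_damping_rv R n e e0) (integrable_normc iK).
  apply: (cintegrable_le mPsi ig) => p.
  by rewrite /Psi !Normc.normcM normc_cis2pi mulr1 normc_real normcJ ger0_norm ?damping_ge0.
have dotE t w : dot (t - s) w = - dot s w + dot t w.
  rewrite /dot -sumrN -big_split; apply: eq_bigr => i _; rewrite !mxE/=; ring.
transitivity (cint (leb \x leb)%E Psi).
  rewrite cint_prod1//; apply: eq_cint => w.
  rewrite fourierJ// -cintZ; last first.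
    apply: cintegrable_mull_le1 => //; last by move=> t; rewrite normc_cis2pi.
    apply: measurable_cis2pi; exact: measurable_dotr.
  by apply: eq_cint => t; rewrite /Psi/= dotE cis2piD; ring.
rewrite cint_prod2//.
have E t : cint leb (fun w => Psi (w, t)) = (poisson e (t - s))%:C * (K t)^*.
  have [i1 <-] := cint_damping_rv (t - s) e0.
  rewrite mulrC -cintZ//; apply: eq_cint => w; rewrite /Psi/=; ring.
rewrite (eq_cint _ E).
have iE : cintegrable leb (fun t => (poisson e (t - s))%:C * (K t)^*).
  (* The Poisson kernel is maximal at the origin, with value [(pi * e)^-1] in
     each coordinate. *)
  have [M PM] : exists M, forall u : 'rV[R]_n, `|poisson e u| <= M.
    exists (\prod_(i < n) (pi * e)^-1) => u; rewrite /poisson normr_prod.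
    apply: ler_prod => i _.
    rewrite normr_ge0/= ger0_norm; last first.
      by rewrite /poisson1 divr_ge0 ?(ltW e0)// mulr_ge0 ?pi_ge0// addr_ge0// sqr_ge0.
    rewrite /poisson1 ler_pdivrMr; last first.
      by rewrite mulr_gt0 ?pi_gt0// ltr_wpDr ?sqr_ge0// exprn_gt0.
    rewrite [leRHS](_ : _ = (e ^+ 2 + u 0 i ^+ 2) / e); last first.
      move: (pi_gt0 R) => /lt0r_neq0; generalize (pi : R) => p p0.
      by field; rewrite p0 gt_eqF.
    by rewrite ler_pdivlMr// -expr2 lerDl sqr_ge0.
  apply: (cintegrable_le _ (integrable_mull M (integrable_normc iK))).
    have := cmeasurable_cint leb (cmeasurable_comp mPsi (@measurable_swap _ _ _ _)).
    by under eq_fun do rewrite E.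
  move=> t; rewrite Normc.normcM normc_real normcJ.
  by rewrite ler_wpM2r ?normc_ge0.
have e00 : e != 0 by rewrite gt_eqF.
have [iE' ->] := cint_affine_rv s e00 iE.
rewrite -cintZ//; apply: eq_cint => v.
rewrite addrK mulrA; congr (_ * _).
by rewrite (gtr0_norm e0) -(poissonZ v e0) rmorphM.
Qed.

End damped_parseval.

End parseval.

(** * Parseval's identity *)

Section parseval_limit.
Context {R : realType} {n : nat}.
Notation normc := Normc.normc.
Notation leb := (@lebesgue_rv R n).
Implicit Types (F K : 'rV[R]_n -> R[i]).
Notation eps := (fun k : nat => k.+1%:R^-1 : R).

Lemma ccvgJ (z_ : nat -> R[i]) z : ccvg z_ z -> ccvg (fun k => (z_ k)^*) z^*.
Proof.
have ReJ (y : R[i]) : complex.Re (y^*) = complex.Re y by case: y.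
have ImJ (y : R[i]) : complex.Im (y^*) = - complex.Im y by case: y.
move=> [z1 z2]; split.
- by rewrite ReJ; under eq_fun do rewrite ReJ.
- by rewrite ImJ; under eq_fun do rewrite ImJ; exact: cvgN.
Qed.

Lemma ccvg_real (u_ : nat -> R) (u : R) : u_ k @[k --> \oo] --> u -> ccvg (fun k => (u_ k)%:C) u%:C.
Proof. by move=> cu; split => //=; exact: cvg_cst. Qed.

Lemma tame_cvg K (v s : 'rV[R]_n) : tame K -> ccvg (fun k => K (eps k *: v + s)) (K s).
Proof.
move=> [cK1 cK2 _ _].
have cs : eps k *: v + s @[k --> \oo] --> s.
  rewrite -[X in _ --> X](add0r s) -(scale0r v).
  apply: cvgD; last exact: cvg_cst.
  by apply: cvgZ; [exact: cvg_harmonic|exact: cvg_cst].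
split.
- exact: (cvg_comp _ _ cs (cK1 s)).
- exact: (cvg_comp _ _ cs (cK2 s)).
Qed.

Lemma cint_poisson (c : R[i]) : cint leb (fun v => (poisson 1 v)%:C * c) = c.
Proof.
have iP : cintegrable leb (fun v => (poisson 1 v)%:C).
  by split => /=; [exact: integrable_poisson|exact: integrable0].
have cP : cint leb (fun v => (poisson 1 v)%:C) = 1.
  by rewrite /cint /= Rintegral_poisson /Rintegral integral0.
transitivity (cint leb (fun v => c * (poisson 1 v)%:C)).
  by apply: eq_cint => v; rewrite mulrC.
by rewrite cintZ// cP mulr1.
Qed.

(** Dominated convergence is applied twice: for fixed [s], in the variable [v] of
    the Poisson kernel, and then in [s]. *)
Lemma ccvg_damped F K : tame F -> tame K ->
  ccvg (fun k => cint leb (fun w =>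
    (damping (eps k) w)%:C * (fourier F w * (fourier K w)^*)))
  (cint leb (fun s => F s * (K s)^*)).
Proof.
move=> tF tK; have [_ _ iF _] := tF; have [_ _ iK [M KM]] := tK.
have e0 k : 0 < eps k by rewrite invr_gt0.
have mK := tame_measurable tK.
have mP : measurable_fun setT (@poisson R n 1).
  exact: (proj1 (measurable_EFinP _ _) (measurable_int _ (@integrable_poisson R n))).
pose J k s := cint leb (fun v => (poisson 1 v)%:C * (K (eps k *: v + s))^*).
have JE k : cint leb (fun w => (damping (eps k) w)%:C * (fourier F w * (fourier K w)^*))
    = cint leb (fun s => F s * J k s).
  rewrite (cint_damped_fourier_prod iF iK (e0 k)); apply: eq_cint => s.
  by rewrite (cint_damped_fourier iK s (e0 k)).
under [X in ccvg X _]funext do rewrite JE.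
have M0 : 0 <= M := le_trans (normc_ge0 _) (KM 0).
have mJin k : cmeasurable (fun p : 'rV[R]_n * 'rV[R]_n =>
    (poisson 1 p.2)%:C * (K (eps k *: p.2 + p.1))^*).
  apply: cmeasurableM; first exact: (cmeasurable_real (measurableT_comp mP measurable_snd)).
  apply: (cmeasurable_comp (f := fun x => (K x)^*) (cmeasurableJ mK)).
  apply: measurable_fun_rvP => i; under eq_fun do rewrite !mxE.
  apply: measurable_funD; last exact: (measurableT_comp (measurable_rv_coord i) measurable_fst).
  apply: measurable_funM => //.
  exact: (measurableT_comp (measurable_rv_coord i) measurable_snd).
have mJs k s : cmeasurable (fun v => (poisson 1 v)%:C * (K (eps k *: v + s))^*).
  exact: (cmeasurable_comp (mJin k) (measurable_pair1 s)).
have PM k s v : normc ((poisson 1 v)%:C * (K (eps k *: v + s))^*) <= M * poisson 1 v.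
  by rewrite Normc.normcM normc_real normcJ mulrC ger0_norm ?poisson_ge0// ler_wpM2r ?poisson_ge0.
have iMP := integrable_mull M (@integrable_poisson R n).
have iJ k s := cintegrable_le (mJs k s) iMP (PM k s).
have JM k s : normc (J k s) <= 2 * M.
  apply: le_trans (normc_cint_le (iJ k s)) _; rewrite ler_wpM2l//.
  have -> : M = Rintegral leb setT (fun v => M * poisson 1 v).
    rewrite RintegralZl//; last exact: integrable_poisson.
    by rewrite Rintegral_poisson mulr1.
  exact: (le_Rintegral measurableT (integrable_normc (iJ k s)) iMP (fun v _ => PM k s v)).
apply: (cint_dominated (g := fun s => (2 * M) * normc (F s))).
- move=> k; apply: cmeasurableM; first exact: tame_measurable.
  exact: (cmeasurable_cint leb (mJin k)).
- by apply: cmeasurableM; [exact: tame_measurable|exact: cmeasurableJ].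
- move=> s; apply: ccvgM; first exact: ccvg_cst.
  rewrite -[X in ccvg _ X](cint_poisson (K s)^*).
  apply: (cint_dominated (g := fun v => M * poisson 1 v)) => //.
  + apply: cmeasurableM; [exact: cmeasurable_real|exact: cmeasurable_cst].
  + move=> v; apply: ccvgM; first exact: ccvg_cst.
    exact/ccvgJ/tame_cvg.
- exact/integrable_mull/integrable_normc.
- by move=> k s; rewrite Normc.normcM mulrC ler_wpM2r ?normc_ge0.
Qed.

Lemma cintegrable_damped F K e : 0 < e -> cintegrable leb F -> cintegrable leb K ->
  cintegrable leb (fun w => (damping e w)%:C * (fourier F w * (fourier K w)^*)).
Proof.
move=> e0 iF iK.
have iD := @integrable_damping_rv R n e e0.
have mD := proj1 (measurable_EFinP _ _) (measurable_int _ iD).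
pose B G := 2 * Rintegral leb setT (fun t => normc (G t)).
apply: (cintegrable_le _ (integrable_mull (B F * B K) iD)).
  apply: cmeasurableM; first exact: cmeasurable_real.
  apply: cmeasurableM; first exact: (cmeasurable_fourier (cintegrable_measurable iF)).
  exact: (cmeasurableJ (cmeasurable_fourier (cintegrable_measurable iK))).
move=> w; rewrite !Normc.normcM normc_real normcJ mulrC ger0_norm ?damping_ge0//.
rewrite ler_wpM2r ?damping_ge0//.
by apply: ler_pM; [exact: normc_ge0|exact: normc_ge0|exact: normc_fourier_le..].
Qed.

Lemma integrable_normc_sqr F : tame F ->
  leb.-integrable setT (EFin \o (fun x => normc (F x) ^+ 2)).
Proof.
move=> tF; have [_ _ iF [M FM]] := tF.
apply: (le_integrable measurableT _ _ (integrable_mull M (integrable_normc iF))).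
  exact/measurable_EFinP/measurable_funX/measurable_normc/(tame_measurable tF).
move=> x _ /=; rewrite lee_fin ger0_norm ?sqr_ge0//.
apply: (le_trans _ (ler_norm _)).
by rewrite expr2 ler_wpM2r// normc_ge0.
Qed.

(** The damping factors increase to 1, so the left-hand side is the limit of the
    damped integrals by monotone convergence, which requires no integrability of
    the Fourier transform. *)
Lemma plancherel F : tame F ->
  (\int[leb]_w (normc (fourier F w) ^+ 2)%:E = \int[leb]_x (normc (F x) ^+ 2)%:E)%E.
Proof.
move=> tF; have [_ _ iF _] := tF.
have e0 k : 0 < eps k by rewrite invr_gt0.
have mF := cmeasurable_fourier (tame_measurable tF).
pose g k w := (damping (eps k) w * normc (fourier F w) ^+ 2)%:E.
have gE k w : g k w = (complex.Re ((damping (eps k) w)%:C * (fourier F w * (fourier F w)^*)))%:E.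
  by rewrite /g normc_sqr Re_cM /= mul0r subr0.
have iD k := cintegrable_damped (e0 k) iF iF.
have intgE k : (\int[leb]_w g k w)%E = (complex.Re (cint leb (fun w =>
    (damping (eps k) w)%:C * (fourier F w * (fourier F w)^*))))%:E.
  rewrite /cint /= /Rintegral fineK; last by case: (iD k) => i1 _; exact: integrable_fin_num.
  by apply: eq_integral => w _; rewrite gE.
have mg k : measurable_fun setT (g k).
  apply/measurable_EFinP/measurable_funM.
    exact: (proj1 (measurable_EFinP _ _) (measurable_int _ (@integrable_damping_rv R n _ (e0 k)))).
  exact/measurable_funX/measurable_normc.
have limg w : limn (g^~ w) = (normc (fourier F w) ^+ 2)%:E.
  apply/cvg_lim => //; apply: cvg_EFin; first exact: nearW.
  rewrite -[X in _ --> X]mul1r; apply: cvgM; last exact: cvg_cst.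
  exact: damping_cvg.
have c1 : (\int[leb]_w g k w)%E @[k --> \oo] --> (\int[leb]_w (normc (fourier F w) ^+ 2)%:E)%E.
  rewrite (_ : integral _ _ _ = \int[leb]_w limn (g^~ w))%E; last first.
    by apply: eq_integral => w _; rewrite limg.
  apply: cvg_monotone_convergence => //.
  - by move=> k w _; rewrite lee_fin mulr_ge0 ?damping_ge0 ?sqr_ge0.
  - move=> w _ k l kl; rewrite lee_fin ler_wpM2r ?sqr_ge0//; apply: le_damping.
    by rewrite lef_pV2 ?posrE// ler_nat.
have c2 : (\int[leb]_w g k w)%E @[k --> \oo] --> (\int[leb]_x (normc (F x) ^+ 2)%:E)%E.
  under eq_fun do rewrite intgE.
  rewrite -(fineK (integrable_fin_num measurableT (integrable_normc_sqr tF))).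
  apply: cvg_EFin; first exact: nearW.
  have [c _] := ccvg_damped tF tF.
  rewrite (_ : fine _ = complex.Re (cint leb (fun s => F s * (F s)^*)))//.
  by rewrite /cint/=; apply: eq_Rintegral => x _; rewrite normc_sqr.
exact: cvg_unique c1 c2.
Qed.

Lemma integrable_fourier_sqr F : tame F ->
  leb.-integrable setT (EFin \o (fun w => normc (fourier F w) ^+ 2)).
Proof.
move=> tF; have /integrableP[_ fin] := integrable_normc_sqr tF.
apply/integrableP; split.
  apply/measurable_EFinP/measurable_funX/measurable_normc.
  exact: (cmeasurable_fourier (tame_measurable tF)).
have E (u : 'rV[R]_n -> R) : (\int[leb]_x `|(EFin \o (fun x => u x ^+ 2)%R) x|
    = \int[leb]_x (u x ^+ 2)%:E)%E.
  by apply: eq_integral => x _ /=; rewrite ger0_norm ?sqr_ge0.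
by rewrite (E (fun w => normc (fourier F w))) plancherel// -(E (fun w => normc (F w))).
Qed.

Lemma normcM_le (z w : R[i]) : normc (z * w) <= normc z ^+ 2 + normc w ^+ 2.
Proof.
rewrite Normc.normcM; have := normc_ge0 z; have := normc_ge0 w.
move: (normc z) (normc w) => x y; nra.
Qed.

(** By Plancherel's identity for [F] and [K], the product of the transforms is
    integrable, so the damping can be removed by dominated convergence. *)
Theorem parseval F K : tame F -> tame K ->
  cintegrable leb (fun w => fourier F w * (fourier K w)^*) /\
  cint leb (fun w => fourier F w * (fourier K w)^*) = cint leb (fun s => F s * (K s)^*).
Proof.
move=> tF tK; have [_ _ iF _] := tF; have [_ _ iK _] := tK.
have ig := integrableD measurableT (integrable_fourier_sqr tF) (integrable_fourier_sqr tK).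
have m12 : cmeasurable (fun w => fourier F w * (fourier K w)^*).
  apply: cmeasurableM; first exact: (cmeasurable_fourier (tame_measurable tF)).
  exact: (cmeasurableJ (cmeasurable_fourier (tame_measurable tK))).
have le12 w : normc (fourier F w * (fourier K w)^*) <=
    normc (fourier F w) ^+ 2 + normc (fourier K w) ^+ 2.
  by rewrite -[normc (fourier K w)]normcJ; exact: normcM_le.
split; first exact: (cintegrable_le m12 ig le12).
apply: ccvg_unique (ccvg_damped tF tK).
apply: (cint_dominated (g := fun w => normc (fourier F w) ^+ 2 + normc (fourier K w) ^+ 2)) => //.
- move=> k; apply: (cintegrable_measurable (mu := leb)).
  by apply: cintegrable_damped => //; rewrite invr_gt0.
- move=> w; rewrite -[X in ccvg _ X]mul1r.
  by apply: ccvgM; [exact/ccvg_real/damping_cvg|exact: ccvg_cst].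
- move=> k w; apply: (le_trans _ (le12 w)); rewrite Normc.normcM normc_real.
  by rewrite ler_piMl ?normc_ge0// ger0_norm ?damping_ge0// damping_le1// invr_ge0.
Qed.

End parseval_limit.

(** * Continuous functions with product decay *)

Section decaying_functions.
Context {R : realType}.
Notation normc := Normc.normc.

Definition ccontinuous n (f : 'rV[R]_n -> R[i]) :=
  continuous (fun x => complex.Re (f x)) /\ continuous (fun x => complex.Im (f x)).

Lemma ccontinuousM n (f g : 'rV[R]_n -> R[i]) :
  ccontinuous f -> ccontinuous g -> ccontinuous (fun x => f x * g x).
Proof.
move=> [f1 f2] [g1 g2]; split.
- rewrite (_ : (fun _ => _) = fun x => complex.Re (f x) * complex.Re (g x)
    - complex.Im (f x) * complex.Im (g x)); last by apply/funext => x; rewrite Re_cM.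
  by move=> x; exact: (continuousB (continuousM (f1 x) (g1 x)) (continuousM (f2 x) (g2 x))).
- rewrite (_ : (fun _ => _) = fun x => complex.Re (f x) * complex.Im (g x)
    + complex.Im (f x) * complex.Re (g x)); last by apply/funext => x; rewrite Im_cM.
  by move=> x; exact: (continuousD (continuousM (f1 x) (g2 x)) (continuousM (f2 x) (g1 x))).
Qed.

Lemma ccontinuousJ n (f : 'rV[R]_n -> R[i]) :
  ccontinuous f -> ccontinuous (fun x => (f x)^*).
Proof.
have ReJ (y : R[i]) : complex.Re (y^*) = complex.Re y by case: y.
have ImJ (y : R[i]) : complex.Im (y^*) = - complex.Im y by case: y.
move=> [f1 f2]; split.
- by under eq_fun do rewrite ReJ.
- rewrite (_ : (fun _ => _) = fun x => - complex.Im (f x)).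
    by move=> x; exact: (continuousN (f2 x)).
  by apply/funext => x; rewrite ImJ.
Qed.

Lemma ccontinuous_affine n (f : 'rV[R]_n -> R[i]) (a : R) (b : 'rV[R]_n) :
  ccontinuous f -> ccontinuous (fun x => f (b + a *: x)).
Proof.
move=> [f1 f2].
have cS : continuous (fun x : 'rV[R]_n => b + a *: x).
  move=> x; apply: (@continuousD _ _ _ (fun=> b) (fun x : 'rV[R]_n => a *: x) x).
    exact: cst_continuous.
  exact: scaler_continuous.
split => x.
- exact: (continuous_comp (cS x) (f1 _)).
- exact: (continuous_comp (cS x) (f2 _)).
Qed.

Lemma ccontinuous_character n (w : 'rV[R]_n) : ccontinuous (fun t => cis2pi (dot w t)).
Proof.
have cdot : continuous (fun t : 'rV[R]_n => dot w t).
  rewrite /dot; elim: (index_enum _) => [|i r IH].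
    by under eq_fun do rewrite big_nil; exact: cst_continuous.
  under eq_fun do rewrite big_cons.
  move=> t; apply: (@continuousD _ _ _ (fun t : 'rV[R]_n => w 0 i * t 0 i)
    (fun t : 'rV[R]_n => \sum_(j <- r) w 0 j * t 0 j)); last exact: IH.
  apply: (@continuousM _ _ (fun=> w 0 i) (fun t : 'rV[R]_n => t 0 i)).
    exact: cst_continuous.
  exact: coord_continuous.
have c2 : continuous (fun t : 'rV[R]_n => 2 * pi * dot w t).
  move=> t; apply: (@continuousM _ _ (fun=> 2 * pi) (fun t : 'rV[R]_n => dot w t)).
    exact: cst_continuous.
  exact: cdot.
split => t /=.
- exact: (continuous_comp (c2 t) (@continuous_cos R _)).
- exact: (continuous_comp (c2 t) (@continuous_sin R _)).
Qed.

Lemma ccontinuous_measurable n (f : 'rV[R]_n -> R[i]) : ccontinuous f -> cmeasurable f.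
Proof. by move=> [f1 f2]; split; exact: continuous_measurable_rv. Qed.

(** The decay is stated with a product over the coordinates, so that its
    integrability is a one-dimensional fact. *)
Definition decaying n (f : 'rV[R]_n -> R[i]) :=
  ccontinuous f /\ exists C : R, forall x, normc (f x) <= C * decay x.

Lemma decay_gt0 n (x : 'rV[R]_n) : 0 < decay x.
Proof. by apply: prodr_gt0 => i _; rewrite invr_gt0 ltr_wpDr// sqr_ge0. Qed.

Lemma decay_le1 n (x : 'rV[R]_n) : decay x <= 1.
Proof.
apply: numdomain.Num.Theory.prodr_ile1 => i _.
rewrite invr_ge0 addr_ge0 ?sqr_ge0//= invf_le1 ?lerDl ?sqr_ge0//.
by rewrite ltr_wpDr// sqr_ge0.
Qed.

Lemma decaying_ge0 n (f : 'rV[R]_n -> R[i]) : decaying f ->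
  exists2 C, 0 <= C & forall x, normc (f x) <= C * decay x.
Proof.
move=> [_ [C fC]]; exists C => //.
by have := le_trans (normc_ge0 _) (fC 0); rewrite pmulr_lge0 ?decay_gt0.
Qed.

Lemma decaying_tame n (f : 'rV[R]_n -> R[i]) : decaying f -> tame f.
Proof.
move=> /[dup] df [cf _]; have [C C0 fC] := decaying_ge0 df; have [f1 f2] := cf.
split => //; last first.
  by exists C => x; apply: le_trans (fC x) _; rewrite ler_piMr// decay_le1.
apply: (cintegrable_le (ccontinuous_measurable cf) (integrable_mull C (@integrable_decay R n))).
exact: fC.
Qed.

(** Peetre's inequality; in each coordinate the difference of the two sides of
    [1 + (a - b)^2 <= 2 (1 + a^2) (1 + b^2)] is [1 + (a + b)^2 + 2 (a b)^2]. *)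
Lemma decayB n (u v : 'rV[R]_n) : decay u * decay v <= 2 ^+ n * decay (u - v).
Proof.
have -> : (2 : R) ^+ n = \prod_(i < n) 2 by rewrite prodr_const card_ord.
rewrite /decay -!big_split/=.
apply: ler_prod => i _; rewrite !mxE.
set a := u 0 i; set b := v 0 i.
have pos (c : R) : 0 < 1 + c ^+ 2 by rewrite ltr_wpDr// sqr_ge0.
apply/andP; split; first by rewrite mulr_ge0// invr_ge0; exact: ltW.
rewrite -invfM ler_pdivlMr// mulrC ler_pdivrMr ?mulr_gt0//.
have := sqr_ge0 (a + b); have := sqr_ge0 (a * b); nra.
Qed.

(** Expanding the product of the [1 + x_i ^ 2] gives a sum over the subsets of the
    coordinates of monomials with exponents 0 and 2; each of them times [f] is
    bounded by the seminorm at [h = 1] with no derivative. *)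
Lemma GS_decaying n (f : 'rV[R]_n -> R[i]) : GS f -> decaying f.
Proof.
move=> [smf nf]; split.
  by have [[+ _] [+ _]] := smf 0%N.
have := nf 1 ltr01.
set S := GS_norm 1 f => Soo.
have bound p x : `|monomial p x| * normc (f x) <= fine S * (mnorm p)`!%:R.
  have m0 : mpartial (fun=> 0%N) f x = f x.
    rewrite /mpartial /mpartialR.
    have id0 (h : 'rV[R]_n -> R) : foldr (fun i : 'I_n => iter 0 (partial i)) h (enum 'I_n) = h.
      by elim: (enum _) => //= i r ->.
    by rewrite !id0; case: (f x).
  have mn0 : mnorm (fun _ : 'I_n => 0%N) = 0%N by rewrite /mnorm big1.
  have le_S : ((`|monomial p x| * normc (f x) / (mnorm p)`!%:R)%:E <= S)%E.
    apply: ereal_sup_ubound; exists p, (fun=> 0%N), x.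
    by rewrite m0 mn0 expr1n mul1r fact0 mulr1.
  have Sfin : S \is a fin_num.
    by rewrite fin_numElt Soo andbT; apply: lt_le_trans le_S; rewrite ltNyr.
  by rewrite -ler_pdivrMr ?ltr0n ?fact_gt0// -lee_fin fineK.
(* [J] is the set of coordinates where the summand 1 is chosen in the expansion,
   hence the exponent 0 there. *)
pose pJ (J : {set 'I_n}) (i : 'I_n) : nat := if i \in J then 0%N else 2%N.
exists (\sum_(J : {set 'I_n}) fine S * (mnorm (pJ J))`!%:R) => x.
have decayV : decay x = (\prod_i (1 + x 0 i ^+ 2))^-1 by rewrite /decay prodfV.
rewrite decayV ler_pdivlMr; last by apply: prodr_gt0 => i _; rewrite ltr_wpDr// sqr_ge0.
rewrite bigA_distr mulr_sumr; apply: ler_sum => J _.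
rewrite mulrC; apply: le_trans (bound (pJ J) x).
rewrite ler_wpM2r ?normc_ge0//; apply: le_trans (ler_norm _).
rewrite le_eqVlt; apply/orP; left; apply/eqP; apply: eq_bigr => i _.
by rewrite /pJ; case: ifP; rewrite ?expr0.
Qed.

Lemma decaying_shift n (w x : 'rV[R]_n) (f : 'rV[R]_n -> R[i]) :
  decaying f -> decaying (modulation w (translation x f)).
Proof.
move=> /[dup] df [cf _]; have [C C0 fC] := decaying_ge0 df; split.
  apply: ccontinuousM; first exact: ccontinuous_character.
  rewrite /translation (_ : (fun _ => _) = fun t => f (- x + 1 *: t)).
    exact: ccontinuous_affine.
  by apply/funext => t; rewrite scale1r addrC.
exists (C * (2 ^+ n / decay (- x))) => t.
rewrite /modulation /translation Normc.normcM normc_cis2pi mul1r.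
apply: le_trans (fC _) _; rewrite -mulrA ler_wpM2l//.
rewrite mulrAC ler_pdivlMr ?decay_gt0//.
by apply: le_trans (decayB _ _) _; rewrite opprK subrK.
Qed.

(** The function whose Fourier transform is the tau-Wigner distribution at [x]. *)
Definition slice n (tau : R) (f g : 'rV[R]_n -> R[i]) (x t : 'rV[R]_n) : R[i] :=
  f (x + tau *: t) * (g (x - (1 - tau) *: t))^*.

(** The arguments of [f] and [g] differ by [t], so Peetre's inequality gives the
    decay in [t] even when [tau] is 0 or 1 and only one factor depends on [t]. *)
Lemma decaying_slice n (tau : R) (f g : 'rV[R]_n -> R[i]) (x : 'rV[R]_n) :
  decaying f -> decaying g -> decaying (slice tau f g x).
Proof.
move=> df dg; have [C C0 fC] := decaying_ge0 df; have [D D0 gD] := decaying_ge0 dg.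
split.
  apply: ccontinuousM; first by apply: ccontinuous_affine; case: df.
  apply: ccontinuousJ; rewrite (_ : (fun _ => _) = fun t => g (x + (- (1 - tau)) *: t)).
    by apply: ccontinuous_affine; case: dg.
  by apply/funext => t; rewrite scaleNr.
exists (C * D * 2 ^+ n) => t.
rewrite /slice Normc.normcM normcJ.
apply: le_trans (ler_pM (normc_ge0 _) (normc_ge0 _) (fC _) (gD _)) _.
rewrite mulrACA -[leRHS]mulrA ler_wpM2l ?mulr_ge0//.
apply: le_trans (decayB _ _) _.
rewrite (_ : x + _ - _ = t)//; apply/rowP => i; rewrite !mxE; ring.
Qed.

End decaying_functions.

(** * Moyal's identity and the comparison of the operators *)

Section moyal.
Context {R : realType} {n : nat}.
Notation normc := Normc.normc.
Notation leb := (@lebesgue_rv R n).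
Implicit Types (f g phi : 'rV[R]_n -> R[i]).

Lemma integralCnE m (f : 'rV[R]_m -> R[i]) : cmeasurable f ->
  integralCn f = cint (lebesgue_rv m) f.
Proof. by move=> [f1 f2]; rewrite /integralCn !integralRnE. Qed.

Definition shear (tau : R) (p : 'rV[R]_n * 'rV[R]_n) : 'rV[R]_n * 'rV[R]_n :=
  (p.1 + tau *: p.2, p.1 - (1 - tau) *: p.2).

Lemma measurable_lincomb (a b : R) :
  measurable_fun setT (fun p : 'rV[R]_n * 'rV[R]_n => a *: p.1 + b *: p.2).
Proof.
apply: measurable_fun_rvP => i; under eq_fun do rewrite !mxE.
apply: measurable_funD; apply: measurable_funM => //.
- exact: (measurableT_comp (measurable_rv_coord i) measurable_fst).
- exact: (measurableT_comp (measurable_rv_coord i) measurable_snd).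
Qed.

Lemma measurable_shear tau : measurable_fun setT (shear tau).
Proof.
rewrite (_ : shear tau = fun p => (1 *: p.1 + tau *: p.2, 1 *: p.1 + (- (1 - tau)) *: p.2)).
  by apply: measurable_fun_pair; exact: measurable_lincomb.
by apply/funext => p; rewrite /shear !scale1r scaleNr.
Qed.

(** The shear is composed of a translation of [x] for fixed [t] and a point
    reflection of [t] for fixed [x], and each preserves Lebesgue measure. *)
Lemma ge0_integral_shear tau (h : 'rV[R]_n * 'rV[R]_n -> \bar R) :
  measurable_fun setT h -> (forall p, 0 <= h p)%E ->
  (\int[leb \x leb]_p h p = \int[leb \x leb]_p h (shear tau p))%E.
Proof.
move=> mh h0.
have ge0_translate (u : 'rV[R]_n -> \bar R) b : measurable_fun setT u -> (forall x, 0 <= u x)%E ->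
    (\int[leb]_x u x = \int[leb]_x u (x + b)%R)%E.
  move=> mu u0; rewrite (ge0_integral_rv_affine b (oner_neq0 R))//.
  rewrite normr1 expr1n mul1e.
  by apply: eq_integral => x _; rewrite scale1r.
have ge0_reflect (u : 'rV[R]_n -> \bar R) b : measurable_fun setT u -> (forall x, 0 <= u x)%E ->
    (\int[leb]_x u x = \int[leb]_x u (b - x)%R)%E.
  move=> mu u0; have N1 : -1 != 0 :> R by rewrite oppr_eq0 oner_eq0.
  rewrite (ge0_integral_rv_affine b N1)// normrN1 expr1n mul1e.
  by apply: eq_integral => x _; rewrite scaleN1r addrC.
pose k (p : 'rV[R]_n * 'rV[R]_n) := h (p.1, p.1 - p.2).
have mk : measurable_fun setT k.
  apply: (measurableT_comp mh).
  rewrite (_ : (fun _ => _) = fun p : 'rV[R]_n * 'rV[R]_n =>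
    (1 *: p.1 + 0 *: p.2, 1 *: p.1 + (-1) *: p.2)).
    by apply: measurable_fun_pair; exact: measurable_lincomb.
  by apply/funext => p; rewrite scale0r addr0 !scale1r scaleN1r.
have mhS : measurable_fun setT (h \o shear tau) by apply: measurableT_comp => //; exact: measurable_shear.
have k0 p : (0 <= k p)%E by exact: h0.
transitivity (\int[leb \x leb]_p k p)%E.
  rewrite (fubini_tonelli1 _ mh h0) (fubini_tonelli1 _ mk k0).
  apply: eq_integral => x _.
  rewrite /fubini_F/= (ge0_reflect (fun y => h (x, y)) x)//.
  exact: (measurableT_comp mh (measurable_pair1 x)).
rewrite (fubini_tonelli2 _ mk k0) (fubini_tonelli2 _ mhS (fun p => h0 _)).
apply: eq_integral => t _.
rewrite /fubini_G (ge0_translate (fun x => k (x, t)) (tau *: t))//; last first.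
  exact: (measurableT_comp mk (measurable_pair2 t)).
apply: eq_integral => x _; rewrite /k /shear/=; congr (h (_, _)).
by rewrite scalerBl scale1r opprB addrA.
Qed.

Lemma cmeasurable_slice tau f g : cmeasurable f -> cmeasurable g ->
  cmeasurable (fun p => slice tau f g p.1 p.2).
Proof.
move=> mf mg.
apply: (cmeasurable_comp (f := fun q : 'rV[R]_n * 'rV[R]_n => f q.1 * (g q.2)^*) (S := shear tau)).
  apply: cmeasurableM; first exact: (cmeasurable_comp mf measurable_fst).
  exact: (cmeasurable_comp (cmeasurableJ mg) measurable_snd).
exact: measurable_shear.
Qed.

Lemma cmeasurable_fourier_slice tau f g : cmeasurable f -> cmeasurable g ->
  cmeasurable (fun p => fourier (slice tau f g p.1) p.2).
Proof.
move=> mf mg.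
apply: (@cmeasurable_cint _ _ _ _ R leb
  (fun p : ('rV[R]_n * 'rV[R]_n) * 'rV[R]_n =>
    cis2pi (- dot p.2 p.1.2) * slice tau f g p.1.1 p.2)).
apply: cmeasurableM.
  apply: measurable_cis2pi; apply: measurableT_comp => //.
  apply: measurable_dot => //.
  exact: (measurableT_comp measurable_snd measurable_fst).
apply: (cmeasurable_comp (cmeasurable_slice tau mf mg)
  (S := fun p : ('rV[R]_n * 'rV[R]_n) * 'rV[R]_n => (p.1.1, p.2))).
apply: measurable_fun_pair => //.
exact: (measurableT_comp measurable_fst measurable_fst).
Qed.

Lemma cint_shear tau (h : 'rV[R]_n * 'rV[R]_n -> R[i]) : cmeasurable h ->
  cint (leb \x leb)%E (fun p => h (shear tau p)) = cint (leb \x leb)%E h.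
Proof.
by move=> mh; rewrite [RHS](cint_change (@ge0_integral_shear tau) mh).
Qed.

Lemma cintegrable_shear tau (h : 'rV[R]_n * 'rV[R]_n -> R[i]) :
  cintegrable (leb \x leb)%E h -> cintegrable (leb \x leb)%E (fun p => h (shear tau p)).
Proof.
move=> ih.
exact: (proj1 (cintegrable_change (@measurable_shear tau) (@ge0_integral_shear tau)
  (cintegrable_measurable ih)) ih).
Qed.

(** Tonelli's theorem and Plancherel's identity in each slice reduce this to the
    square integrability of the slices, which are integrable and bounded. *)
Lemma integrable_fourier_slice_sqr tau f g : decaying f -> decaying g ->
  (leb \x leb)%E.-integrable setT
    (EFin \o (fun p => normc (fourier (slice tau f g p.1) p.2) ^+ 2)).
Proof.
move=> df dg.
have [cf _] := df; have [cg _] := dg.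
have mf := ccontinuous_measurable cf; have mg := ccontinuous_measurable cg.
have mW := cmeasurable_fourier_slice tau mf mg.
have mS := cmeasurable_slice tau mf mg.
have tf := decaying_tame df; have tg := decaying_tame dg.
have [_ _ iF [M FM]] := tf; have [_ _ iG [N GN]] := tg.
have isl : cintegrable (leb \x leb)%E (fun p => slice tau f g p.1 p.2).
  apply: (cintegrable_shear tau (h := fun q => f q.1 * (g q.2)^*)).
  exact: (cintegrable_prod iF (cintegrableJ iG)).
have mW2 : measurable_fun setT (fun p => (normc (fourier (slice tau f g p.1) p.2) ^+ 2)%:E).
  exact/measurable_EFinP/measurable_funX/measurable_normc.
have mS2 : measurable_fun setT (fun p => (normc (slice tau f g p.1 p.2) ^+ 2)%:E).
  exact/measurable_EFinP/measurable_funX/measurable_normc.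
have iS2 : (leb \x leb)%E.-integrable setT
    (EFin \o (fun p => normc (slice tau f g p.1 p.2) ^+ 2)).
  apply: (le_integrable measurableT _ _ (integrable_mull (M * N) (integrable_normc isl))).
    exact: mS2.
  move=> p _ /=; rewrite lee_fin ger0_norm ?sqr_ge0//.
  apply: (le_trans _ (ler_norm _)).
  rewrite expr2 ler_wpM2r ?normc_ge0// /slice Normc.normcM normcJ.
  by apply: ler_pM; [exact: normc_ge0|exact: normc_ge0|exact: FM|exact: GN].
apply/integrableP; split; first exact: mW2.
have /integrableP[_] := iS2.
have E (u : 'rV[R]_n * 'rV[R]_n -> R) : (\int[leb \x leb]_p `|(EFin \o (fun p => u p ^+ 2)%R) p|
    = \int[leb \x leb]_p (u p ^+ 2)%:E)%E.
  by apply: eq_integral => x _ /=; rewrite ger0_norm ?sqr_ge0.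
rewrite (E (fun p => normc (slice tau f g p.1 p.2))).
rewrite (E (fun p => normc (fourier (slice tau f g p.1) p.2))).
have sqr0 (u : 'rV[R]_n * 'rV[R]_n -> R) p : (0 <= (u p ^+ 2)%:E)%E.
  by rewrite lee_fin sqr_ge0.
rewrite (fubini_tonelli1 _ mS2 (sqr0 _)) (fubini_tonelli1 _ mW2 (sqr0 _)).
apply: le_lt_trans; rewrite le_eqVlt; apply/orP; left; apply/eqP.
apply: eq_integral => x _; rewrite /fubini_F/= plancherel//.
exact/decaying_tame/decaying_slice.
Qed.

(** Parseval's identity in each slice, followed by the shear that separates the
    variables. *)
Lemma moyal tau f g phi psi :
  decaying f -> decaying g -> decaying phi -> decaying psi ->
  let W := fun p => fourier (slice tau f g p.1) p.2 * (fourier (slice tau phi psi p.1) p.2)^* in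
  cint (leb \x leb)%E W =
  cint leb (fun u => f u * (phi u)^*) * cint leb (fun v => (g v)^* * psi v).
Proof.
move=> df dg dphi dpsi W.
have mE h : decaying h -> cmeasurable h by move=> [ch _]; exact: ccontinuous_measurable.
have mW : cmeasurable W.
  apply: cmeasurableM; first by apply: cmeasurable_fourier_slice; exact: mE.
  by apply: cmeasurableJ; apply: cmeasurable_fourier_slice; exact: mE.
have iW : cintegrable (leb \x leb)%E W.
  have ig := integrableD measurableT (integrable_fourier_slice_sqr tau df dg)
    (integrable_fourier_slice_sqr tau dphi dpsi).
  apply: (cintegrable_le mW ig) => p.
  by apply: le_trans (normcM_le _ _) _; rewrite normcJ.
have iM h k : decaying h -> decaying k -> cintegrable leb (fun u => h u * (k u)^*).
  move=> dh dk; have [_ _ ih _] := decaying_tame dh; have [_ _ _ [M kM]] := decaying_tame dk.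
  apply: (cintegrable_le _ (integrable_mull M (integrable_normc ih))).
    by apply: cmeasurableM; [exact: mE|apply: cmeasurableJ; exact: mE].
  by move=> x; rewrite Normc.normcM normcJ mulrC ler_wpM2r ?normc_ge0.
have iA := iM f phi df dphi.
have iB : cintegrable leb (fun v => (g v)^* * psi v).
  have := iM psi g dpsi dg.
  by rewrite (_ : (fun u => psi u * (g u)^*) = fun v => (g v)^* * psi v)//;
    apply/funext => v; rewrite mulrC.
rewrite (cint_prod1 iW) -(cint_prod iA iB).
rewrite -(cint_shear tau (cintegrable_measurable (cintegrable_prod iA iB))).
have sE p : (f (shear tau p).1 * (phi (shear tau p).1)^*) *
    ((g (shear tau p).2)^* * psi (shear tau p).2) =
    slice tau f g p.1 p.2 * (slice tau phi psi p.1 p.2)^*.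
  by rewrite /slice conjcM conjcK /shear/=; ring.
have iS := cintegrable_shear tau (cintegrable_prod iA iB).
rewrite (cint_prod1 iS); apply: eq_cint => x.
have [_ ->] := parseval (decaying_tame (decaying_slice tau x df dg))
  (decaying_tame (decaying_slice tau x dphi dpsi)).
by apply: eq_cint => t; rewrite (sE (x, t)).
Qed.

Lemma wignerE tau f g z : decaying f -> decaying g ->
  wigner tau f g z = fourier (slice tau f g (lsubmx z)) (rsubmx z).
Proof.
move=> df dg.
have ds := decaying_slice tau (lsubmx z) df dg.
rewrite /wigner/= integralCnE.
  by apply: eq_cint => t; rewrite /slice mulrA.
rewrite (_ : (fun _ => _) = fun t => cis2pi (- dot t (rsubmx z)) * slice tau f g (lsubmx z) t).
  apply: cmeasurableM; first exact: cmeasurable_character.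
  by case: ds => [cs _]; exact: ccontinuous_measurable.
by apply/funext => t; rewrite /slice mulrA.
Qed.

(** Covariance under phase-space shifts: the arguments of the two factors of a
    slice differ by [t], so the phases of the modulations combine into the
    character [cis2pi (dot w' t)], which shifts the frequency. *)
Lemma wignerB tau f g z z' : decaying f -> decaying g ->
  wigner tau f g (z - z') =
  fourier (slice tau (modulation (rsubmx z') (translation (lsubmx z') f))
                     (modulation (rsubmx z') (translation (lsubmx z') g)) (lsubmx z)) (rsubmx z).
Proof.
move=> df dg; rewrite wignerE//; apply: eq_cint => t.
rewrite /slice /modulation /translation.
set x := lsubmx z; set w := rsubmx z; set x' := lsubmx z'; set w' := rsubmx z'.
have -> : lsubmx (z - z') = x - x' by rewrite linearB.
have -> : rsubmx (z - z') = w - w' by rewrite linearB.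
have dotE : - dot t (w - w') = - dot t w + (dot w' (x + tau *: t) - dot w' (x - (1 - tau) *: t)).
  rewrite /dot -!sumrN -!big_split/=; apply: eq_bigr => i _; rewrite !mxE; ring.
rewrite dotE !cis2piD !cis2piN conjcM.
have -> : x - x' + tau *: t = x + tau *: t - x' by rewrite addrAC.
have -> : x - x' - (1 - tau) *: t = x - (1 - tau) *: t - x' by rewrite addrAC.
ring.
Qed.

Lemma STFTE phi f z : decaying phi -> decaying f ->
  STFT phi f z = cint leb (fun u => f u * (modulation (rsubmx z) (translation (lsubmx z) phi) u)^*).
Proof.
move=> dphi df; rewrite /STFT /inner_product integralCnE//.
have [cm _] := decaying_shift (rsubmx z) (lsubmx z) dphi; have [cf _] := df.
by apply: cmeasurableM; [|apply: cmeasurableJ]; exact: ccontinuous_measurable.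
Qed.

Lemma measurable_submx :
  measurable_fun setT (fun z : 'rV[R]_(n + n) => (lsubmx z, rsubmx z)).
Proof.
apply: measurable_fun_pair; apply: measurable_fun_rvP => i.
- by under eq_fun do rewrite mxE; exact: measurable_rv_coord.
- by under eq_fun do rewrite mxE; exact: measurable_rv_coord.
Qed.

(** Moyal's identity for the windows shifted by [z']. *)
Lemma wigner_convolution_STFT tau f g phi1 phi2 z' :
  decaying f -> decaying g -> decaying phi1 -> decaying phi2 ->
  integralCn (fun z => wigner tau g f z * (wigner tau phi2 phi1 (z - z'))^*) =
  (STFT phi1 f z')^* * STFT phi2 g z'.
Proof.
move=> df dg dphi1 dphi2.
have dM1 := decaying_shift (rsubmx z') (lsubmx z') dphi1.
have dM2 := decaying_shift (rsubmx z') (lsubmx z') dphi2.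
pose W (p : 'rV[R]_n * 'rV[R]_n) :=
  fourier (slice tau g f p.1) p.2 *
  (fourier (slice tau (modulation (rsubmx z') (translation (lsubmx z') phi2))
                      (modulation (rsubmx z') (translation (lsubmx z') phi1)) p.1) p.2)^*.
have -> : (fun z => wigner tau g f z * (wigner tau phi2 phi1 (z - z'))^*) =
    W \o (fun z => (lsubmx z, rsubmx z)).
  by apply/funext => z; rewrite /W/= wignerE// wignerB.
have mE h : decaying h -> cmeasurable h by move=> [ch _]; exact: ccontinuous_measurable.
have mW : cmeasurable W.
  apply: cmeasurableM; first by apply: cmeasurable_fourier_slice; exact: mE.
  by apply: cmeasurableJ; apply: cmeasurable_fourier_slice; exact: mE.
have mWz := cmeasurable_comp mW measurable_submx.
rewrite integralCnE//.
have SE (h : 'rV[R]_(n + n) -> \bar R) : measurable_fun setT h -> (forall z, 0 <= h z)%E ->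
    (\int[lebesgue_rv (n + n)]_z h z = \int[leb \x leb]_p h (row_mx p.1 p.2))%E.
  move=> mh h0; rewrite ge0_integral_row_mx// fubini_tonelli1//.
  by apply: measurableT_comp => //; exact: measurable_row_mx.
rewrite (cint_change SE mWz).
transitivity (cint (leb \x leb)%E W).
  by apply: eq_cint => -[x w]; rewrite /= row_mxKl row_mxKr.
rewrite moyal// mulrC STFTE// [in RHS]STFTE//; congr (_ * _).
rewrite -cintJ; first by apply: eq_cint => v; rewrite conjcM conjcK.
have [_ _ iF _] := decaying_tame df; have [_ _ _ [M kM]] := decaying_tame dM1.
apply: (cintegrable_le _ (integrable_mull M (integrable_normc iF))).
  by apply: cmeasurableM; [exact: mE|apply: cmeasurableJ; exact: mE].
by move=> x; rewrite Normc.normcM normcJ mulrC ler_wpM2r ?normc_ge0.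
Qed.

End moyal.

Unset Implicit Arguments.

Theorem proposition2p11 (R : realType) (d : nat) (d_gt0 : (0 < d)%N)
  (phi1 phi2 : 'rV[R]_d -> R[i])
  (phi1_GS : GS phi1) (phi1_neq0 : phi1 <> cst 0)
  (phi2_GS : GS phi2) (phi2_neq0 : phi2 <> cst 0)
  (a : functional R (d + d)) (a_dual : GS_dual a)
  (tau : R) (tau01 : 0 <= tau <= 1) :
  forall f : 'rV[R]_d -> R[i], GS f ->
  forall g : 'rV[R]_d -> R[i], GS g ->
    bracket (loc_op phi1 phi2 a f) g = bracket (tau_loc_op tau phi1 phi2 a f) g.
Proof.
move=> f /GS_decaying df g /GS_decaying dg.
have dphi1 := GS_decaying phi1_GS; have dphi2 := GS_decaying phi2_GS.
rewrite /loc_op /tau_loc_op /tau_quantization /convolution !bracketE.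
congr (bracket a _); apply/funext => z'; apply/esym.
exact: wigner_convolution_STFT.
Qed.
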